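(* Let $F=u\,\phi(r,s)$ be a spherically symmetric Finsler metric in $\mathbb{R}^n$, where $r=|x|$, $u=|y|$, $s=\frac{\langle x,y\rangle}{|y|}$. Then $F$ is a Berwald metric if and only if either $F$ is Riemannian, or there exist a smooth function $c_2(r)$ and a function $\psi$ of one variable such that \[F=u\,\psi\left(\frac{s^2}{g(r)+s^2\int 2rc_2(r)g(r)\,dr}\right)e^{-\int \left(\frac{2}{r}-r^3c_2(r)\right)dr}\,s,\] where $g(r)=e^{\int \left(\frac{2}{r}-2r^3c_2(r)\right)dr}$.
   Context: Here $\langle\cdot,\cdot\rangle$ and $|\cdot|$ are the standard Euclidean inner product and norm on $\mathbb{R}^n$, $x$ lies in a domain $\Omega\subseteq\mathbb{R}^n$, and $y\in T_x\Omega\cong\mathbb{R}^n$ is a nonzero tangent vector. A Finsler metric $F=F(x,y)$ on $\Omega$ is called spherically symmetric if it is invariant under all rotations of $\mathbb{R}^n$; then $F=u\,\phi(r,s)$ for a positive function $\phi$ of two variables. With $g_{ij}=\frac12\frac{\partial^2F^2}{\partial y^i\partial y^j}$ and inverse $g^{ij}$, the geodesic spray coefficients are $G^i=\frac14 g^{il}\{(F^2)_{x^ky^l}y^k-(F^2)_{x^l}\}$ (summation convention). The Berwald curvature is $B^i_{\ jkl}=\frac{\partial^3G^i}{\partial y^j\partial y^k\partial y^l}$, and $F$ is a Berwald metric if $B^i_{\ jkl}=0$. $F$ is Riemannian if $g_{ij}$ does not depend on $y$. The integrals $\int\cdots dr$ denote indefinite integrals (antiderivatives) in $r$.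
   Formalization: The formula for F is asserted only where s is nonzero (at s=0 it would give F=0), with possibly different functions ψ for s>0 and for s<0 (a single ψ would make F odd in y); n≥2 is assumed; c_2 is smooth on the positive values of r attained, for some choice of antiderivatives. *)

(* Defs.v *)
From mathcomp Require Export all_boot all_order all_algebra.
From mathcomp Require Export all_classical all_reals all_analysis.
Export Order.TTheory GRing.Theory Num.Theory numFieldNormedType.Exports.

Set Implicit Arguments.
Unset Strict Implicit.
Unset Printing Implicit Defensive.

Local Open Scope classical_set_scope.
Local Open Scope ring_scope.

(* Points and tangent vectors are row vectors.  The library norm `|x| on
   'rV[R]_n is the sup norm (with the usual topology), hence [enorm]. *)

Definition dot (R : realType) (n : nat) (x y : 'rV[R]_n) : R :=
  \sum_(i < n) x ord0 i * y ord0 i.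

Definition enorm (R : realType) (n : nat) (x : 'rV[R]_n) : R :=
  Num.sqrt (dot x x).

(* The variable s = <x, y> / |y|. *)
Definition svar (R : realType) (n : nat) (x y : 'rV[R]_n) : R :=
  dot x y / enorm y.

(* C^oo on an open set U: every iterated directional derivative, including f
   itself, is Frechet differentiable at every point of U. *)
Definition smooth_on (R : realType) (V : normedModType R) (U : set V)
    (f : V -> R^o) : Prop :=
  forall (vs : seq V) (p : V), U p ->
    differentiable (foldr (fun v h => (fun q => 'D_v h q) : V -> R^o) f vs) p.

Definition antiderivative_on (R : realType) (J : set R) (f H : R -> R) : Prop :=
  forall r : R, J r -> is_derive r (1 : R) H (f r).

Definition domain (R : realType) (n : nat) (Omega : set 'rV[R]_n) : Prop :=
  [/\ Omega !=set0, open Omega & connected Omega].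

(* The positive values of r = |x| on Omega; r = 0 is left out because the
   integrands involve 2 / r. *)
Definition radii (R : realType) (n : nat) (Omega : set 'rV[R]_n) : set R :=
  [set r | exists x, [/\ Omega x, x != 0 & r = enorm x]].

Section FinslerGeometry.
Variables (R : realType) (n : nat).
Implicit Types (Omega : set 'rV[R]_n) (F : 'rV[R]_n -> 'rV[R]_n -> R).

Definition basis_vec (i : 'I_n) : 'rV[R]_n := delta_mx ord0 i.

Definition partial (i : 'I_n) (f : 'rV[R]_n -> R) (p : 'rV[R]_n) : R :=
  'D_(basis_vec i) (f : 'rV[R]_n -> R^o) p.

(* In the curried definitions below, x-derivatives are taken with y fixed, and
   y-derivatives with x fixed. *)

Definition fundamental_tensor F (x y : 'rV[R]_n) : 'M[R]_n :=
  \matrix_(i < n, j < n)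
    (2^-1 * partial i (partial j (fun y' => F x y' ^+ 2)) y).

Definition spray F (i : 'I_n) (x y : 'rV[R]_n) : R :=
  4^-1 * \sum_(l < n) invmx (fundamental_tensor F x y) i l *
    (\sum_(k < n)
        partial k (fun x' => partial l (fun y' => F x' y' ^+ 2) y) x * y ord0 k
     - partial l (fun x' => F x' y ^+ 2) x).

Definition berwald_curvature F (i j k l : 'I_n) (x y : 'rV[R]_n) : R :=
  partial j (partial k (partial l (spray F i x))) y.

(* Only the values F x y with x in Omega and y != 0 are meaningful. *)
Definition finsler_metric Omega F : Prop :=
  [/\ forall x y, Omega x -> y != 0 -> 0 < F x y,
      forall x y (a : R), Omega x -> y != 0 -> 0 < a -> F x (a *: y) = a * F x y,
      smooth_on [set p : 'rV[R]_n * 'rV[R]_n | Omega p.1 /\ p.2 != 0]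
        (fun p => F p.1 p.2)
    & forall x y (v : 'rV[R]_n), Omega x -> y != 0 -> v != 0 ->
        0 < (v *m fundamental_tensor F x y *m v^T) ord0 ord0].

Definition rotation (A : 'M[R]_n) : Prop := A *m A^T = 1%:M /\ \det A = 1.

Definition spherically_symmetric Omega F : Prop :=
  forall A : 'M[R]_n, rotation A -> forall x, Omega x ->
    Omega (x *m A) /\ forall y, y != 0 -> F (x *m A) (y *m A) = F x y.

(* F = u phi(r, s) with phi positive; phi matters only at the attained pairs
   (r, s). *)
Definition radial_form Omega F (phi : R -> R -> R) : Prop :=
  forall x y, Omega x -> y != 0 ->
    0 < phi (enorm x) (svar x y) /\
    F x y = enorm y * phi (enorm x) (svar x y).

Definition berwald_metric Omega F : Prop :=
  forall x y, Omega x -> y != 0 ->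
    forall i j k l : 'I_n, berwald_curvature F i j k l x y = 0.

Definition riemannian Omega F : Prop :=
  forall x y y', Omega x -> y != 0 -> y' != 0 ->
    fundamental_tensor F x y = fundamental_tensor F x y'.

(* F has the form
     u psi (s^2 / (g + s^2 \int 2 r c2 g dr)) e^(- \int (2/r - r^3 c2) dr) s,
   with g = e^(\int (2/r - 2 r^3 c2) dr); I1, I2, I3 are the chosen
   antiderivatives, and the quotient is required to make sense.
   The expression carries the odd factor s while the argument of psi is even in
   s, and F > 0.  So the identity is stated off the hypersurface s = 0 (where
   the formula reads 0, and F is recovered by continuity), and psi is a pair of
   functions of one variable: psi true on the component s > 0, psi false on the
   component s < 0. *)
Definition berwald_form Omega F (c2 : R -> R) (psi : bool -> R -> R) : Prop :=
  exists I1 I2 I3 : R -> R,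
    let g r := expR (I1 r) in
    let denom r s := g r + s ^+ 2 * I2 r in
    [/\ antiderivative_on (radii Omega) (fun r => 2 / r - 2 * r ^+ 3 * c2 r) I1,
        antiderivative_on (radii Omega) (fun r => 2 * r * c2 r * g r) I2,
        antiderivative_on (radii Omega) (fun r => 2 / r - r ^+ 3 * c2 r) I3
      & forall x y, Omega x -> y != 0 ->
          let r := enorm x in let u := enorm y in let s := svar x y in
          s != 0 ->
          denom r s != 0 /\
          F x y = u * psi (0 < s) (s ^+ 2 / denom r s) * expR (- I3 r) * s].

End FinslerGeometry.

(* Main.v *)
(* Proof idea. Put L = F^2 and G for the spray. Differentiating the spray equation in y, antisymmetrising
   and contracting with y gives L_{x^m} = (d G^i / d y^m) L_{y^i} for every Finsler metric. If F is
   Berwald, the right-hand side comes from a connection that is linear in y. At x = r e, compare it in a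
   plane spanned by e and a unit vector v orthogonal to e with the derivative of L along rotations: since
   L is invariant under the reflection v -> -v, either L(x, .) is a quadratic form, or the connection is
   that of the product of a line with the round sphere, so that the restriction of F to the tangent
   spaces, read in cylindrical coordinates, does not depend on r. The second alternative is open and
   closed in r as long as F is not Riemannian, and it is a restatement of the formula: e^(- I3) s u and
   the argument of psi are functions of the cylindrical components of y. Conversely the formula makes F
   constant along the horizontal curves of that product connection, which by the spray equation is
   therefore the spray of F. *)

(* The dichotomy is a linear ODE for [L] as a function of the slope in the plane of e and v: unless
   its coefficients vanish, the solutions are quadratic. If they vanish, only a rate of radial
   stretching is left, and it must be half the logarithmic derivative of [lam r = F (r e, e)^2].
   Write p and q for the radial and tangential components of y. In the rescaled components
   [P = sqrt lam * p] and [Q = q / r], the energy then has derivative 0 in r. This also explains the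
   formula: [c2] is chosen so that [g = 1 / lam], after which [e^(- I3) u s = P] and the argument of
   psi is [1 / (1 + (Q / P)^2)], for suitable constants of integration. Two obstacles shape the
   proof. A tangent space without 0 is not convex, so the linearity of the connection is integrated
   along segments that start at e and avoid 0; the line [q = 0], the hypersurface [s = 0] and, in
   the converse, the point [x = 0] are reached by continuity. And phi and psi carry no regularity,
   so derivatives are always taken on [L], along curves on which its values are known. *)
From HB Require Import structures.
From mathcomp Require Import ring lra.
Require Import Defs.

Set Implicit Arguments.
Unset Strict Implicit.
Unset Printing Implicit Defensive.

Local Open Scope classical_set_scope.
Local Open Scope ring_scope.

(** * Smooth functions *)

Section SmoothFunctions.
Context {R : realType} {V : normedModType R}.
Implicit Types (U : set V) (f g : V -> R^o) (p v w : V).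

(** [g] is [f] plus a function that vanishes near [p], whose differential is 0 by uniqueness of the
    differential. *)
Lemma near_eq_differentiable f g p :
  (\forall q \near p, f q = g q) -> differentiable f p -> differentiable g p.
Proof.
move=> fg df.
have hnear : \forall q \near p, (g - f) q = 0.
  by near=> q; rewrite !fctE (near fg q)// subrr.
have h0 : (g - f) p = 0 by exact: (nbhs_singleton hnear).
have Eh : (g - f) \o shift p = cst ((g - f) p) + (0 : V -> R^o) +o_ 0 id.
  apply/eqaddoP => e e0; rewrite h0.
  have : \forall h \near (0 : V), (g - f) (h + p) = 0.
    by move: hnear; rewrite (near_shift 0)/=; apply: filterS => h /=; rewrite subr0.
  apply: filterS => h /= Hh.
  rewrite !fctE/= in Hh *; rewrite Hh !addr0 subrr normr0.
  by rewrite mulr_ge0// ltW.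
have dh : differentiable (g - f) p.
  have cont0 : continuous (0 : V -> R^o) by move=> x; exact: cvg_cst.
  apply/diff_locallyP.
  have -> : 'd (g - f) p = (0 : V -> R^o) :> (V -> R^o).
    exact: (@diff_unique _ _ _ _ (\0%R : {linear V -> R^o})).
  by split.
have -> : g = f + (g - f) by rewrite addrC subrK.
exact: differentiableD.
Unshelve. all: by end_near. Qed.

Lemma is_derive_curve (f : V -> R^o) (c : R -> V) (t : R) (dc : V) :
  is_derive t (1 : R) c dc -> differentiable f (c t) ->
  is_derive t (1 : R) (f \o c) ('D_dc f (c t)).
Proof.
move=> [dvc Ec] df.
have dfc : differentiable c t by exact/derivable1_diffP.
have dcomp : differentiable (f \o c) t by exact: differentiable_comp.
split; first exact/derivable1_diffP.
by rewrite deriveE// diff_comp//= deriveE// -Ec (deriveE _ dfc).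
Qed.

Lemma is_derive_line p v t : is_derive t (1 : R) (fun s : R => p + s *: v) v.
Proof.
have -> : (fun s : R => p + s *: v) = cst p + ( *:%R ^~ v) by [].
rewrite -[X in is_derive _ _ _ X]add0r; apply: is_deriveD.
split; first exact/derivable1_diffP.
by rewrite deriveE// diff_val scale1r.
Qed.

(** Recursion on the order replaces the lists of directions in [smooth_on], so that closure under
    products and inverses becomes an induction. [Ck 0] already asks for differentiability: in [Ck k]
    up to k derivatives are taken, and each result is differentiable. *)
Fixpoint Ck (k : nat) U f : Prop :=
  (forall p, U p -> differentiable f p) /\
  if k is k'.+1 then forall v, Ck k' U ('D_v f) else True.

Lemma Ck_differentiable k U f p : Ck k U f -> U p -> differentiable f p.
Proof. by case: k => [|k] [+ _]; apply. Qed.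

Lemma smooth_onP U f : smooth_on U f <-> forall k, Ck k U f.
Proof.
split=> [sf k|].
  elim: k f sf => [|k IH] f sf; split=> //; try by move=> p; exact: (sf [::]).
  move=> v; apply: IH => vs p Up.
  by have := sf (rcons vs v) p Up; rewrite foldr_rcons.
(* The last direction of the list is the innermost derivative, hence the induction from the
   right. *)
move=> Hf vs; elim/last_ind: vs f Hf => [|vs v IH] f Hf p Up.
  exact: Ck_differentiable (Hf 0%N) Up.
rewrite foldr_rcons; apply: IH => // k.
by have [_] := Hf k.+1; apply.
Qed.

Lemma smooth_on_differentiable U f p : smooth_on U f -> U p -> differentiable f p.
Proof. by move=> sf; exact: (sf [::]). Qed.

Lemma smooth_on_derive U f v : smooth_on U f -> smooth_on U ('D_v f).
Proof. by move=> /smooth_onP sf; apply/smooth_onP => k; have [_] := sf k.+1; apply. Qed.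

Section OpenDomain.
Variables (U : set V).
Hypothesis openU : open U.

Lemma near_in_open p (P : set V) : U p -> (forall q, U q -> P q) -> \forall q \near p, P q.
Proof. by move=> Up UP; have := open_nbhs_nbhs (conj openU Up); apply: filterS. Qed.

(** Since [U] is open, formulas for derivatives need to hold on [U] only; the closure lemmas below
    rewrite derivatives through this. *)
Lemma Ck_eq k f g : (forall p, U p -> f p = g p) -> Ck k U f -> Ck k U g.
Proof.
elim: k f g => [|k IH] f g fg [df Df]; split=> //; try (move=> p Up;
    by apply: (near_eq_differentiable _ (df _ Up)); exact: near_in_open).
move=> v; apply: IH (Df v) => p Up.
by apply: near_eq_derive; exact: near_in_open.
Qed.

Lemma smooth_on_eq f g : (forall p, U p -> f p = g p) -> smooth_on U f -> smooth_on U g.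
Proof. by move=> fg /smooth_onP sf; apply/smooth_onP => k; exact: Ck_eq (sf k). Qed.

Lemma Ck_le k f : Ck k.+1 U f -> Ck k U f.
Proof.
elim: k f => [|k IH] f [df Df]; split=> // v.
exact: IH.
Qed.

Lemma Ck_cst k (a : R^o) : Ck k U (cst a).
Proof.
elim: k a => [|k IH] a; split=> //.
move=> v; apply: (@Ck_eq _ (cst 0)) => // p _; by rewrite derive_cst.
Qed.

Lemma Ck_add k f g : Ck k U f -> Ck k U g -> Ck k U (fun p => f p + g p).
Proof.
elim: k f g => [|k IH] f g [df Df] [dg Dg]; split=> //; try by
  move=> p Up; apply: (differentiableD (f := f) (g := g)); [exact: df|exact: dg].
move=> v; apply: (@Ck_eq _ (fun p => 'D_v f p + 'D_v g p)); last exact: IH (Df v) (Dg v).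
by move=> p Up; rewrite -deriveD//; apply: diff_derivable; [exact: df|exact: dg].
Qed.

Lemma Ck_mul k f g : Ck k U f -> Ck k U g -> Ck k U (fun p => (f p : R) * g p).
Proof.
elim: k f g => [|k IH] f g Hf Hg; have [df Df] := Hf; have [dg Dg] := Hg; split=> //; try by
  move=> p Up; apply: (differentiableM (f := f) (g := g)); [exact: df|exact: dg].
move=> v; apply: (@Ck_eq _ (fun p => (f p : R) * 'D_v g p + (g p : R) * 'D_v f p)).
  by move=> p Up; rewrite (deriveM (f := f) (g := g))//; apply: diff_derivable; [exact: df|exact: dg].
by apply: Ck_add; apply: IH; [exact: Ck_le Hf|exact: Dg|exact: Ck_le Hg|exact: Df].
Qed.

(** The derivative of [1/f] is [- (1/f)^2] times that of [f], so [1/f] enters at one order lower and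
    the induction closes with [f] fixed. *)
Lemma Ck_inv k f : (forall p, U p -> f p != 0) -> Ck k U f ->
  Ck k U (fun p => (f p : R)^-1).
Proof.
move=> f0; elim: k => [|k IH] Hf; have [df Df] := Hf; split=> //; try by
  move=> p Up; apply: (differentiableV (f := f)); [exact: df|exact: f0].
move=> v; apply: (@Ck_eq _ (fun p => (-1) * ((f p : R)^-1 * (f p : R)^-1) * 'D_v f p)).
  move=> p Up; rewrite (deriveV (f := f)) ?f0//; last by apply: diff_derivable; exact: df.
  by rewrite /GRing.scale/= mulN1r -invfM expr2.
have Hfi := IH (Ck_le Hf).
apply: (@Ck_mul _ (fun p => (-1) * ((f p : R)^-1 * (f p : R)^-1)) ('D_v f)); last exact: Df.
apply: (@Ck_mul _ (cst (-1 : R)) (fun p => (f p : R)^-1 * (f p : R)^-1)).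
  exact: Ck_cst.
exact: (@Ck_mul _ (fun p => (f p : R)^-1) (fun p => (f p : R)^-1)).
Qed.

Lemma smooth_on_cst (a : R^o) : smooth_on U (cst a).
Proof. by apply/smooth_onP => k; exact: Ck_cst. Qed.

Lemma smooth_onD f g : smooth_on U f -> smooth_on U g -> smooth_on U (fun p => f p + g p).
Proof. by move=> /smooth_onP sf /smooth_onP sg; apply/smooth_onP => k; exact: Ck_add. Qed.

Lemma smooth_onM f g : smooth_on U f -> smooth_on U g ->
  smooth_on U (fun p => (f p : R) * g p).
Proof. by move=> /smooth_onP sf /smooth_onP sg; apply/smooth_onP => k; exact: Ck_mul. Qed.

Lemma smooth_onV f : (forall p, U p -> f p != 0) -> smooth_on U f ->
  smooth_on U (fun p => (f p : R)^-1).
Proof. by move=> f0 /smooth_onP sf; apply/smooth_onP => k; exact: Ck_inv. Qed.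

Lemma smooth_onB f g : smooth_on U f -> smooth_on U g -> smooth_on U (fun p => f p - g p).
Proof.
move=> sf sg.
apply: (@smooth_on_eq (fun p => f p + (cst (-1 : R^o) p : R) * g p)).
  by move=> p _; rewrite /cst/= mulN1r.
by apply: smooth_onD => //; apply: smooth_onM => //; exact: smooth_on_cst.
Qed.

Lemma smooth_on_sum (I : Type) (r : seq I) (P : pred I) (f : I -> V -> R^o) :
  (forall i, P i -> smooth_on U (f i)) ->
  smooth_on U (fun p => \sum_(i <- r | P i) f i p).
Proof.
move=> sf; elim: r => [|i r IH].
  apply: (@smooth_on_eq (cst 0)); last exact: smooth_on_cst.
  by move=> p _; rewrite big_nil.
have [Pi|Pi] := boolP (P i).
  apply: (@smooth_on_eq (fun p => f i p + \sum_(i <- r | P i) f i p)).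
    by move=> p _; rewrite big_cons Pi.
  by apply: smooth_onD => //; exact: sf.
apply: smooth_on_eq IH => p _; by rewrite big_cons (negbTE Pi).
Qed.

Lemma smooth_on_prod (I : Type) (r : seq I) (P : pred I) (f : I -> V -> R^o) :
  (forall i, P i -> smooth_on U (f i)) ->
  smooth_on U (fun p => (\prod_(i <- r | P i) (f i p : R)) : R^o).
Proof.
move=> sf; elim: r => [|i r IH].
  apply: (@smooth_on_eq (cst (1 : R))); last exact: smooth_on_cst.
  by move=> p _; rewrite big_nil.
have [Pi|Pi] := boolP (P i).
  apply: (@smooth_on_eq (fun p => (f i p : R) * \prod_(i <- r | P i) (f i p : R))).
    by move=> p _; rewrite big_cons Pi.
  by apply: smooth_onM => //; exact: sf.
apply: smooth_on_eq IH => p _; by rewrite big_cons (negbTE Pi).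
Qed.

End OpenDomain.

Lemma smooth_on_linear U (f : {linear V -> R^o}) : open U -> continuous f -> smooth_on U f.
Proof.
move=> oU cf; apply/smooth_onP; case=> [|k]; split=> //; try by
  move=> p Up; exact: linear_differentiable.
move=> v; apply: (@Ck_eq _ oU _ (cst (f v))); last exact: Ck_cst.
by move=> p Up; rewrite deriveE ?diff_lin//; exact: linear_differentiable.
Qed.

End SmoothFunctions.

(** * Symmetry of mixed directional derivatives *)

Section Schwarz.
Context {R : realType} {V : normedModType R}.
Implicit Types (U : set V) (f g : V -> R^o) (p v w : V).

Lemma near_and3 (T : topologicalType) (p : T) (A B C : set T) :
  nbhs p A -> nbhs p B -> nbhs p C -> nbhs p [set q | [/\ A q, B q & C q]].
Proof. by move=> nA nB nC; apply: filterS3 nA nB nC. Qed.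

(* The mean value theorem applied twice to the second difference. *)
Lemma second_difference (f : V -> R^o) p v w (t : R) : 0 < t ->
  (forall a b : R, 0 <= a <= t -> 0 <= b <= t ->
     differentiable f (p + a *: v + b *: w) /\
     differentiable ('D_v f) (p + a *: v + b *: w)) ->
  exists a b : R, [/\ 0 <= a <= t, 0 <= b <= t &
   f (p + t *: v + t *: w) - f (p + t *: v) - f (p + t *: w) + f p
     = t * t * 'D_w ('D_v f) (p + a *: v + b *: w)].
Proof.
move=> t0 Hd.
have line (g : V -> R^o) q u (s : R) : differentiable g (q + s *: u) ->
    is_derive s (1:R) (fun s => g (q + s *: u)) ('D_u g (q + s *: u)).
  by move=> dg; apply: is_derive_curve => //; exact: is_derive_line.
have tt : 0 <= t <= t by rewrite lexx ltW.
have t00 : 0 <= (0:R) <= t by rewrite lexx ltW.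
pose g s : R := f (p + t *: w + s *: v) - f (p + s *: v).
have dg s : 0 <= s <= t -> is_derive s (1:R) g
    ('D_v f (p + t *: w + s *: v) - 'D_v f (p + s *: v)).
  move=> st; apply: is_deriveB; apply: line.
    by rewrite addrAC; have [] := Hd s t st tt.
  by have [] := Hd s 0 st t00; rewrite scale0r addr0.
have incl s : s \in `]0, t[%R -> 0 <= s <= t.
  by rewrite in_itv/= => /andP[? ?]; rewrite !ltW.
have [a aI Ea] : exists2 c, c \in `]0, t[%R & g t - g 0 = 
    ('D_v f (p + t *: w + c *: v) - 'D_v f (p + c *: v)) * (t - 0).
  apply: (MVT t0 (fun s sI => dg s (incl s sI))).
  apply: derivable_within_continuous => s; rewrite in_itv/= => sI.
  by have [] := dg s sI.
have aI' := incl _ aI.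
pose h s : R := 'D_v f (p + a *: v + s *: w).
have dh s : 0 <= s <= t -> is_derive s (1:R) h ('D_w ('D_v f) (p + a *: v + s *: w)).
  by move=> st; apply: line; have [] := Hd a s aI' st.
have [b bI Eb] : exists2 c, c \in `]0, t[%R & h t - h 0 = 
    'D_w ('D_v f) (p + a *: v + c *: w) * (t - 0).
  apply: (MVT t0 (fun s sI => dh s (incl s sI))).
  apply: derivable_within_continuous => s; rewrite in_itv/= => sI.
  by have [] := dh s sI.
exists a, b; split=> //; first exact: incl.
have -> : f (p + t *: v + t *: w) - f (p + t *: v) - f (p + t *: w) + f p = g t - g 0.
  by rewrite /g !scale0r !addr0 (addrAC p (t *: w)); ring.
rewrite Ea subr0.
have -> : 'D_v f (p + t *: w + a *: v) - 'D_v f (p + a *: v) = h t - h 0.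
  by rewrite /h scale0r addr0 addrAC.
rewrite Eb subr0 -[RHS]mulrA mulrC; congr (_ * _); exact: mulrC.
Qed.

(** The second difference over the parallelogram with sides [t v] and [t w] is symmetric in [v] and
    [w]. It equals [t^2] times either mixed derivative at some point of the parallelogram, and both
    mixed derivatives are continuous at [p]. *)
Lemma derive_comm (U : set V) (f : V -> R^o) v w p : open U -> smooth_on U f -> U p ->
  'D_w ('D_v f) p = 'D_v ('D_w f) p.
Proof.
move=> oU sf Up.
set A := 'D_w _ _; set B := 'D_v _ _.
have cA : {for p, continuous ('D_w ('D_v f))}.
  apply: differentiable_continuous; apply: smooth_on_differentiable Up.
  by do 2 apply: smooth_on_derive.
have cB : {for p, continuous ('D_v ('D_w f))}.
  apply: differentiable_continuous; apply: smooth_on_differentiable Up.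
  by do 2 apply: smooth_on_derive.
apply/eqP; rewrite -subr_eq0 -normr_le0; apply/ler_addgt0Pl => e e0; rewrite addr0.
have tri (a b m : R) : `|a - m| < e / 2 -> `|b - m| < e / 2 -> `|a - b| <= e.
  move=> am bm; rewrite -(subrKA m) (splitr e) (le_trans (ler_normD _ _))//.
  by rewrite lerD// ?ltW// distrC.
have e20 : 0 < e / 2 by rewrite divr_gt0.
have near_e : \forall q \near p, [/\ U q, `|A - 'D_w ('D_v f) q| < e / 2 &
    `|B - 'D_v ('D_w f) q| < e / 2].
  have nU : nbhs p U by exact: open_nbhs_nbhs.
  have nA : \forall q \near p, `|A - 'D_w ('D_v f) q| < e / 2.
    by move/cvgrPdist_lt : cA => /(_ _ e20).
  have nB : \forall q \near p, `|B - 'D_v ('D_w f) q| < e / 2.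
    by move/cvgrPdist_lt : cB => /(_ _ e20).
  by exact: near_and3 nU nA nB.
have [d /= d0 Hball] := (nbhs_ballP _ _).1 near_e.
(* This [t] keeps the parallelogram in the ball of radius [d]; the added 1 makes the denominator
   positive even for [v = w = 0]. *)
pose t := d / (2 * (`|v| + `|w| + 1)).
have N0 : 0 < `|v| + `|w| + 1 by rewrite ltr_wpDl// addr_ge0.
have t0 : 0 < t by rewrite divr_gt0// mulr_gt0.
have inball a b : 0 <= a <= t -> 0 <= b <= t -> ball p d (p + a *: v + b *: w).
  move=> /andP[a0 at_] /andP[b0 bt]; rewrite -ball_normE/= /ball_/= -addrA opprD addrA subrr.
  rewrite add0r normrN (le_lt_trans (ler_normD _ _))// !normrZ !ger0_norm//.
  apply: (@le_lt_trans _ _ (t * `|v| + t * `|w|)).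
    by rewrite lerD// ler_wpM2r.
  rewrite -mulrDr; apply: (@lt_trans _ _ (t * (`|v| + `|w| + 1))).
    by rewrite ltr_pM2l// ltrDl.
  rewrite /t invfM mulrA divfK ?gt_eqF//.
  by rewrite ltr_pdivrMr// ltr_pMr// ltr1n.
have [a [b [aI bI E1]]] : exists a b : R, [/\ 0 <= a <= t, 0 <= b <= t &
   f (p + t *: v + t *: w) - f (p + t *: v) - f (p + t *: w) + f p
     = t * t * 'D_w ('D_v f) (p + a *: v + b *: w)].
  apply: second_difference => // a b aI bI; have [Uq _ _] := Hball _ (inball _ _ aI bI).
  by split; apply: smooth_on_differentiable Uq => //; exact: smooth_on_derive.
have [a' [b' [aI' bI' E2]]] : exists a b : R, [/\ 0 <= a <= t, 0 <= b <= t &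
   f (p + t *: w + t *: v) - f (p + t *: w) - f (p + t *: v) + f p
     = t * t * 'D_v ('D_w f) (p + a *: w + b *: v)].
  apply: second_difference => // a' b' aI' bI'.
  have [Uq _ _] := Hball _ (inball _ _ bI' aI'); rewrite [p + _ + _]addrAC.
  by split; apply: smooth_on_differentiable Uq => //; exact: smooth_on_derive.
have [_ HA _] := Hball _ (inball _ _ aI bI).
have [_ _ HB] := Hball _ (inball _ _ bI' aI').
have E : 'D_w ('D_v f) (p + a *: v + b *: w) = 'D_v ('D_w f) (p + b' *: v + a' *: w).
  apply: (@mulfI _ (t * t)); first by rewrite mulf_neq0// gt_eqF.
  rewrite (addrAC p (b' *: v)); apply: (etrans (esym E1)); apply: (etrans _ E2).
  by rewrite (addrAC p (t *: v)) (addrAC (f (p + t *: w + t *: v))).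
rewrite -E in HB.
exact: tri HA HB.
Qed.

End Schwarz.

Section DirectionalDerivatives.
Context {R : realType}.

(** Both sides are derivatives at [t = 0] of functions of one variable. With a factor [c] and two
    base points it serves homogeneity as well as invariance under reflections. *)
Lemma derive_along (V V' : normedModType R) (f : V -> R^o) (g : V' -> R^o) (c : R)
    (p v : V) (q w : V') :
  differentiable f p -> differentiable g q ->
  (\forall t \near (0 : R), f (p + t *: v) = c * g (q + t *: w)) ->
  'D_v f p = c * 'D_w g q.
Proof.
move=> df dg fg.
have D1 : is_derive (0 : R) (1 : R) (f \o (fun t => p + t *: v)) ('D_v f p).
  have := @is_derive_curve R V f (fun t => p + t *: v) 0 v (is_derive_line p v 0).
  by rewrite scale0r addr0; apply.
have D2 : is_derive (0 : R) (1 : R) (c \*: (g \o (fun t => q + t *: w))) (c *: 'D_w g q).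
  apply: is_deriveZ.
  have := @is_derive_curve R V' g (fun t => q + t *: w) 0 w (is_derive_line q w 0).
  by rewrite scale0r addr0; apply.
have [_ E1] := near_eq_is_derive fg D1.
have [_ E2] := D2.
by rewrite -E1 E2.
Qed.

Lemma derive_curve_eq0 (V : normedModType R) (f : V -> R^o) (c : R -> V) (t : R) (dc : V) (k : R) :
  is_derive t (1 : R) c dc -> differentiable f (c t) ->
  (\forall s \near t, f (c s) = k) -> 'D_dc f (c t) = 0.
Proof.
move=> dct df fk.
have D := is_derive_curve dct df.
have [_ <-] := near_eq_is_derive fk D.
exact: derive_cst.
Qed.

Section Linearity.
Context {V : normedModType R}.
Variables (f : V -> R^o) (p : V).
Hypothesis df : differentiable f p.

Lemma derive_dirD v w : 'D_(v + w) f p = 'D_v f p + 'D_w f p.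
Proof. by rewrite !deriveE// linearD. Qed.

Lemma derive_dirZ (a : R) v : 'D_(a *: v) f p = a * 'D_v f p.
Proof. by rewrite !deriveE// linearZ. Qed.

Lemma derive_dir_sum (I : Type) (r : seq I) (P : pred I) (v : I -> V) :
  'D_(\sum_(i <- r | P i) v i) f p = \sum_(i <- r | P i) 'D_(v i) f p.
Proof. by rewrite deriveE// linear_sum; apply: eq_bigr => i _; rewrite deriveE. Qed.

End Linearity.

Lemma derive_sum_mul (V : normedModType R) (I : Type) (r : seq I) (f g : I -> V -> R^o) p v :
  (forall i, differentiable (f i) p) -> (forall i, differentiable (g i) p) ->
  'D_v (fun q => \sum_(i <- r) (f i q : R) * g i q) p =
  \sum_(i <- r) ('D_v (f i) p * g i p + (f i p : R) * 'D_v (g i) p).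
Proof.
move=> df dg.
suff : is_derive p v (fun q => \sum_(i <- r) (f i q : R) * g i q : R^o)
    (\sum_(i <- r) ('D_v (f i) p * g i p + (f i p : R) * 'D_v (g i) p)) by case.
elim: r => [|i r IH].
  rewrite big_nil.
  have -> : (fun q => \sum_(i <- [::]) (f i q : R) * g i q : R^o) = cst 0.
    by apply/funext => q; rewrite big_nil.
  exact: is_derive_cst.
rewrite big_cons.
have -> : (fun q => \sum_(i <- i :: r) (f i q : R) * g i q : R^o) =
  (f i * g i) + (fun q => \sum_(i <- r) (f i q : R) * g i q : R^o).
  by apply/funext => q; rewrite big_cons.
apply: is_deriveD.
have Df : is_derive p v (f i) ('D_v (f i) p) by apply: derivableP; exact: diff_derivable.
have Dg : is_derive p v (g i) ('D_v (g i) p) by apply: derivableP; exact: diff_derivable.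
have := is_deriveM Df Dg.
by congr (is_derive _ _ _ _); rewrite addrC mulrC.
Qed.

End DirectionalDerivatives.

(** * Derivatives in x and in y on the product [V * V] *)

Section TangentBundle.
Context {R : realType} {n : nat}.
Local Notation V := 'rV[R]_n.
Implicit Types (G : V * V -> R^o) (x y v w : V) (p q : V * V).

(** The two difference quotients are the same function of [h]. This carries the curried partial
    derivatives of the definitions to the product, where mixed derivatives commute. *)
Lemma derive_snd G x y v : 'D_v (fun y' => G (x, y')) y = 'D_((0, v) : V * V) G (x, y).
Proof.
rewrite /derive; set phi := (fun h : R => _); set psi := (fun h : R => _).
suff -> : phi = psi by []; apply/funext => h; rewrite /phi /psi/=.
have -> : h *: ((0, v) : V * V) + (x, y) = (x, h *: v + y).
  by congr pair; rewrite /= scaler0 add0r.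
by [].
Qed.

Lemma derive_fst G x y v : 'D_v (fun x' => G (x', y)) x = 'D_((v, 0) : V * V) G (x, y).
Proof.
rewrite /derive; set phi := (fun h : R => _); set psi := (fun h : R => _).
suff -> : phi = psi by []; apply/funext => h; rewrite /phi /psi/=.
have -> : h *: ((v, 0) : V * V) + (x, y) = (h *: v + x, y).
  by congr pair; rewrite /= scaler0 add0r.
by [].
Qed.

Lemma row_basis v : v = \sum_(k < n) v ord0 k *: basis_vec R k.
Proof. exact: row_sum_delta. Qed.

Lemma derive_snd_sum G p v : differentiable G p ->
  'D_((0, v) : V * V) G p = \sum_(k < n) v ord0 k * 'D_((0, basis_vec R k) : V * V) G p.
Proof.
move=> dG.
have -> : ((0, v) : V * V) = \sum_(k < n) v ord0 k *: ((0, basis_vec R k) : V * V).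
  rewrite [LHS]surjective_pairing [RHS]surjective_pairing/= !raddf_sum/=.
  congr pair; last exact: row_basis.
  by rewrite big1// => i _; rewrite scaler0.
by rewrite derive_dir_sum//; apply: eq_bigr => k _; rewrite derive_dirZ.
Qed.

Lemma derive_fst_sum G p v : differentiable G p ->
  'D_((v, 0) : V * V) G p = \sum_(k < n) v ord0 k * 'D_((basis_vec R k, 0) : V * V) G p.
Proof.
move=> dG.
have -> : ((v, 0) : V * V) = \sum_(k < n) v ord0 k *: ((basis_vec R k, 0) : V * V).
  rewrite [LHS]surjective_pairing [RHS]surjective_pairing/= !raddf_sum/=.
  congr pair; first exact: row_basis.
  by rewrite big1// => i _; rewrite scaler0.
by rewrite derive_dir_sum//; apply: eq_bigr => k _; rewrite derive_dirZ.
Qed.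

Definition snd_coord (k : 'I_n) : V * V -> R := fun p => p.2 ord0 k.

Lemma snd_coord_linear (k : 'I_n) : linear (snd_coord k : V * V -> R^o).
Proof. by move=> a u v; rewrite /snd_coord/= !mxE. Qed.

HB.instance Definition _ (k : 'I_n) := GRing.isLinear.Build R (V * V)%type R^o *:%R
  (snd_coord k) (snd_coord_linear k).

Lemma snd_coord_continuous (k : 'I_n) : continuous (snd_coord k : V * V -> R^o).
Proof.
move=> p; apply: (@continuous_comp _ _ _ snd (fun N : V => N ord0 k : R^o)).
  exact: cvg_snd.
exact: coord_continuous.
Qed.

Lemma smooth_snd_coord (U : set (V * V)) (k : 'I_n) : open U -> smooth_on U (snd_coord k).
Proof.
move=> oU.
by apply: smooth_on_linear => //; exact: snd_coord_continuous.
Qed.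

Lemma derive_snd_coord (k : 'I_n) p v : 'D_((0, v) : V * V) (snd_coord k) p = v ord0 k.
Proof.
have dk : differentiable (snd_coord k) p.
  by apply: (smooth_on_differentiable (U := setT)) => //; apply: smooth_snd_coord; exact: openT.
rewrite deriveE//.
by rewrite diff_lin//; exact: snd_coord_continuous.
Qed.

Lemma smooth_on_det m (U : set (V * V)) (M : V * V -> 'M[R]_m) : open U ->
  (forall i j, smooth_on U (fun p => M p i j : R^o)) ->
  smooth_on U (fun p => \det (M p) : R^o).
Proof.
move=> oU sM; rewrite /determinant.
apply: smooth_on_sum => // s _.
set a : R := (-1) ^+ _.
apply: (@smooth_onM _ _ _ oU (cst a) (fun p => \prod_(i < m) M p i (perm.fun_of_perm s i))).
  exact: smooth_on_cst.
by apply: smooth_on_prod => // i _; exact: sM.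
Qed.

(** Cramer's rule: an entry of the inverse is a cofactor divided by the determinant, and both are
    polynomials in the entries. *)
Lemma smooth_on_invmx m (U : set (V * V)) (M : V * V -> 'M[R]_m) : open U ->
  (forall i j, smooth_on U (fun p => M p i j : R^o)) ->
  (forall p, U p -> M p \in unitmx) ->
  forall i j, smooth_on U (fun p => invmx (M p) i j : R^o).
Proof.
move=> oU sM uM i j.
apply: (@smooth_on_eq _ _ _ oU
  (fun p => (\det (M p))^-1 * ((cst ((-1) ^+ (j + i) : R) p : R) * \det (row' j (col' i (M p)))))).
  by move=> p Up; rewrite /invmx uM// !mxE.
apply: (@smooth_onM _ _ _ oU (fun p => (\det (M p))^-1)
  (fun p => (cst ((-1) ^+ (j + i) : R) p : R) * \det (row' j (col' i (M p))))).
  apply: (@smooth_onV _ _ _ oU (fun p => \det (M p) : R^o)); last exact: smooth_on_det.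
  by move=> p Up; have := uM p Up; rewrite unitmxE unitfE.
apply: (@smooth_onM _ _ _ oU (cst ((-1) ^+ (j + i) : R))
  (fun p => \det (row' j (col' i (M p))))); first exact: smooth_on_cst.
apply: smooth_on_det => // a b.
apply: (@smooth_on_eq _ _ _ oU (fun p => M p (lift j a) (lift i b))); last exact: sM.
by move=> p _; rewrite !mxE.
Qed.

End TangentBundle.

(** * Partial derivatives on the slit tangent bundle *)

(* [dx] and [dy] are locked because comparing two distinct iterated derivatives up to conversion does not
   terminate in practice. *)
HB.lock Definition dx (R : realType) (n : nat) (w : 'rV[R]_n)
  (G : 'rV[R]_n * 'rV[R]_n -> R) : 'rV[R]_n * 'rV[R]_n -> R :=
  'D_((w, 0) : 'rV[R]_n * 'rV[R]_n) (G : _ -> R^o).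

HB.lock Definition dy (R : realType) (n : nat) (w : 'rV[R]_n)
  (G : 'rV[R]_n * 'rV[R]_n -> R) : 'rV[R]_n * 'rV[R]_n -> R :=
  'D_((0, w) : 'rV[R]_n * 'rV[R]_n) (G : _ -> R^o).

Section Slit.
Context {R : realType} {n : nat}.
Local Notation V := 'rV[R]_n.
Implicit Types (G : V * V -> R) (x y v w : V) (p q : V * V) (Omega : set V)
  (F : V -> V -> R).

Definition slit Omega : set (V * V) := [set p | Omega p.1 /\ p.2 != 0].

Definition energy F : V * V -> R := fun p => F p.1 p.2 ^+ 2.

Definition spray_coef F (i : 'I_n) : V * V -> R := fun p => spray F i p.1 p.2.

Lemma open_neq0 : open [set y : V | y != 0].
Proof.
have -> : [set y : V | y != 0] = ~` [set 0].
  by apply/seteqP; split=> y /=; [move/eqP|move=> ?; apply/eqP].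
by apply: closed_openC; exact: accessible_closed_set1 (hausdorff_accessible _) _.
Qed.

Lemma open_slit Omega : open Omega -> open (slit Omega).
Proof.
move=> oO.
have -> : slit Omega = (fst @^-1` Omega) `&` (snd @^-1` [set y | y != 0]) by [].
apply: openI; apply: open_comp => //.
- by move=> p _; exact: cvg_fst.
- by move=> p _; exact: cvg_snd.
- exact: open_neq0.
Qed.

Lemma partial_sndE (i : 'I_n) G x y :
  partial i (fun y' => G (x, y')) y = dy (basis_vec R i) G (x, y).
Proof. by rewrite dy.unlock; exact: derive_snd. Qed.

Lemma partial_fstE (i : 'I_n) G x y :
  partial i (fun x' => G (x', y)) x = dx (basis_vec R i) G (x, y).
Proof. by rewrite dx.unlock; exact: derive_fst. Qed.

Lemma fundamental_tensorE F x y i j : fundamental_tensor F x y i j =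
  2^-1 * dy (basis_vec R i) (dy (basis_vec R j) (energy F)) (x, y).
Proof.
have H : partial j (fun y' => F x y' ^+ 2) = fun y' => dy (basis_vec R j) (energy F) (x, y').
  by apply/funext => y'; exact: (partial_sndE j (energy F)).
rewrite /fundamental_tensor mxE H.
by rewrite (partial_sndE i (dy (basis_vec R j) (energy F)) x y).
Qed.

(** The bracket in the formula of the spray; for a Finsler metric it is [4 g_{li} G^i], the spray
    with its index lowered. *)
Definition spray_rhs F (l : 'I_n) : V * V -> R := fun p =>
  \sum_(k < n) p.2 ord0 k * dx (basis_vec R k) (dy (basis_vec R l) (energy F)) p
  - dx (basis_vec R l) (energy F) p.

Lemma spray_coefE F i p : spray_coef F i p =
  4^-1 * \sum_(l < n) invmx (fundamental_tensor F p.1 p.2) i l * spray_rhs F l p.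
Proof.
case: p => x y; rewrite /spray_coef /spray/=.
suff H l : \sum_(k < n)
    partial k (fun x' => partial l (fun y' => F x' y' ^+ 2) y) x * y ord0 k
     - partial l (fun x' => F x' y ^+ 2) x = spray_rhs F l (x, y).
  by under eq_bigr => l _ do rewrite H.
rewrite (partial_fstE l (energy F) x y) /spray_rhs/=.
have H : (fun x' => partial l (fun y' => F x' y' ^+ 2) y) =
    fun x' => dy (basis_vec R l) (energy F) (x', y).
  by apply/funext => x'; exact: (partial_sndE l (energy F)).
rewrite H; under eq_bigr => k _ do
  rewrite (partial_fstE k (dy (basis_vec R l) (energy F)) x y) mulrC.
by [].
Qed.

Lemma berwald_curvatureE F i j k l x y : berwald_curvature F i j k l x y =
  dy (basis_vec R j) (dy (basis_vec R k) (dy (basis_vec R l) (spray_coef F i))) (x, y).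
Proof.
rewrite /berwald_curvature.
have H1 : partial l (spray F i x) = fun y' => dy (basis_vec R l) (spray_coef F i) (x, y').
  by apply/funext => y'; exact: (partial_sndE l (spray_coef F i)).
have H2 : partial k (partial l (spray F i x)) =
    fun y' => dy (basis_vec R k) (dy (basis_vec R l) (spray_coef F i)) (x, y').
  by rewrite H1; apply/funext => y'; exact: (partial_sndE k (dy (basis_vec R l) (spray_coef F i))).
by rewrite H2 (partial_sndE j (dy (basis_vec R k) (dy (basis_vec R l) (spray_coef F i))) x y).
Qed.

End Slit.

Section DerivativesOnOpen.
Context {R : realType} {n : nat}.
Local Notation V := 'rV[R]_n.
Variable W : set (V * V).
Hypothesis oW : open W.
Implicit Types (G H : V * V -> R) (v w : V) (p q : V * V).

Lemma smooth_dx w G : smooth_on W G -> smooth_on W (dx w G).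
Proof. by rewrite dx.unlock; exact: smooth_on_derive. Qed.

Lemma smooth_dy w G : smooth_on W G -> smooth_on W (dy w G).
Proof. by rewrite dy.unlock; exact: smooth_on_derive. Qed.

Lemma dyC v w G p : smooth_on W G -> W p -> dy v (dy w G) p = dy w (dy v G) p.
Proof. by rewrite dy.unlock => sG Wp; exact: derive_comm sG Wp. Qed.

Lemma dxyC v w G p : smooth_on W G -> W p -> dx v (dy w G) p = dy w (dx v G) p.
Proof. by rewrite dx.unlock dy.unlock => sG Wp; exact: derive_comm sG Wp. Qed.

Lemma eq_dx v G H p : W p -> (forall q, W q -> G q = H q) -> dx v G p = dx v H p.
Proof. by rewrite dx.unlock => Wp GH; apply: near_eq_derive; exact: near_in_open Wp GH. Qed.

Lemma eq_dy v G H p : W p -> (forall q, W q -> G q = H q) -> dy v G p = dy v H p.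
Proof. by rewrite dy.unlock => Wp GH; apply: near_eq_derive; exact: near_in_open Wp GH. Qed.

Lemma dyB v G H p : smooth_on W G -> smooth_on W H -> W p ->
  dy v (fun q => G q - H q) p = dy v G p - dy v H p.
Proof.
rewrite dy.unlock => /smooth_on_differentiable sG /smooth_on_differentiable sH Wp.
exact: (deriveB (diff_derivable (sG _ Wp)) (diff_derivable (sH _ Wp))).
Qed.

Lemma dyD v G H p : smooth_on W G -> smooth_on W H -> W p ->
  dy v (fun q => G q + H q) p = dy v G p + dy v H p.
Proof.
rewrite dy.unlock => /smooth_on_differentiable sG /smooth_on_differentiable sH Wp.
exact: (deriveD (diff_derivable (sG _ Wp)) (diff_derivable (sH _ Wp))).
Qed.

Lemma dyZ v (a : R) G p : smooth_on W G -> W p ->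
  dy v (fun q => a * G q) p = a * dy v G p.
Proof.
rewrite dy.unlock => /smooth_on_differentiable sG Wp; exact: (deriveZ a (diff_derivable (sG _ Wp))).
Qed.

Lemma dy_sum_mul v (G H : 'I_n -> V * V -> R) p :
  (forall i, smooth_on W (G i)) -> (forall i, smooth_on W (H i)) -> W p ->
  dy v (fun q => \sum_(i < n) G i q * H i q) p =
  \sum_(i < n) dy v (G i) p * H i p + \sum_(i < n) G i p * dy v (H i) p.
Proof.
rewrite dy.unlock => sG sH Wp; rewrite -big_split/=; apply: derive_sum_mul => i.
  exact: smooth_on_differentiable (sG i) Wp.
exact: smooth_on_differentiable (sH i) Wp.
Qed.

Lemma smooth_on_sum_mul (G H : 'I_n -> V * V -> R) :
  (forall i, smooth_on W (G i)) -> (forall i, smooth_on W (H i)) ->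
  smooth_on W (fun q => \sum_(i < n) G i q * H i q).
Proof.
move=> sG sH; apply: smooth_on_sum => // i _.
exact: (@smooth_onM _ _ _ oW (G i) (H i)).
Qed.

Lemma dy_sum_basis G p v : smooth_on W G -> W p ->
  dy v G p = \sum_(k < n) v ord0 k * dy (basis_vec R k) G p.
Proof. by rewrite dy.unlock => sG Wp; apply: derive_snd_sum; exact: smooth_on_differentiable Wp. Qed.

Lemma dx_sum_basis G p v : smooth_on W G -> W p ->
  dx v G p = \sum_(k < n) v ord0 k * dx (basis_vec R k) G p.
Proof. by rewrite dx.unlock => sG Wp; apply: derive_fst_sum; exact: smooth_on_differentiable Wp. Qed.

Lemma dy_snd_coord (k m : 'I_n) p : dy (basis_vec R m) (snd_coord k) p = (k == m)%:R.
Proof. by rewrite dy.unlock derive_snd_coord mxE eqxx. Qed.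

Lemma snd_coordE (k : 'I_n) p : snd_coord k p = p.2 ord0 k.
Proof. by []. Qed.

End DerivativesOnOpen.

Lemma addr_congr (R : zmodType) (a b c d : R) : a = c -> b = d -> a + b = c + d.
Proof. by move=> -> ->. Qed.

Lemma subr_congr (R : zmodType) (a b c d : R) : a = c -> b = d -> a - b = c - d.
Proof. by move=> -> ->. Qed.

Lemma mulr_congr (R : pzRingType) (a b c d : R) : a = c -> b = d -> a * b = c * d.
Proof. by move=> -> ->. Qed.

(** * Spray and energy of a Finsler metric *)

Section FinslerMetric.
Context {R : realType} {n : nat}.
Local Notation V := 'rV[R]_n.
Variables (Omega : set V) (F : V -> V -> R).
Hypothesis openO : open Omega.
Hypothesis finslerF : finsler_metric Omega F.
Local Notation W := (slit Omega).
Local Notation L := (energy F).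
Local Notation e := (basis_vec R).
Implicit Types (G : V * V -> R) (x y v w : V) (p q : V * V).

Let oW : open W. Proof. exact: open_slit. Qed.

Lemma smooth_energy : smooth_on W L.
Proof.
have [_ _ sF _] := finslerF.
apply: (@smooth_on_eq _ _ _ oW (fun p => (F p.1 p.2 : R) * F p.1 p.2)).
  by move=> p _; rewrite /energy expr2.
exact: (@smooth_onM _ _ _ oW (fun p => F p.1 p.2) (fun p => F p.1 p.2)).
Qed.



Lemma fundamental_tensor_unitmx p : W p -> fundamental_tensor F p.1 p.2 \in unitmx.
Proof.
move=> [Op p0]; have [_ _ _ pos] := finslerF.
rewrite -row_free_unit -kermx_eq0; apply/negPn/negP => /rowV0Pn[v vk v0].
have := pos p.1 p.2 v Op p0 v0.
by move/sub_kermxP: vk => ->; rewrite mul0mx mxE ltxx.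
Qed.

Lemma smooth_spray i : smooth_on W (spray_coef F i).
Proof.
apply: (@smooth_on_eq _ _ _ oW (fun p => (cst (4^-1 : R) p : R) *
    \sum_(l < n) invmx (fundamental_tensor F p.1 p.2) i l * spray_rhs F l p)).
  by move=> p _; rewrite spray_coefE.
apply: (@smooth_onM _ _ _ oW (cst (4^-1 : R)) (fun p =>
    \sum_(l < n) invmx (fundamental_tensor F p.1 p.2) i l * spray_rhs F l p)).
  exact: smooth_on_cst.
apply: smooth_on_sum => // l _.
apply: (@smooth_onM _ _ _ oW (fun p => invmx (fundamental_tensor F p.1 p.2) i l)
  (spray_rhs F l)).
  apply: (@smooth_on_invmx _ _ _ _ (fun p => fundamental_tensor F p.1 p.2)) => //.
    move=> a b.
    apply: (@smooth_on_eq _ _ _ oW (fun p => (cst (2^-1 : R) p : R) *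
        dy (e a) (dy (e b) L) p)).
      by move=> [x y] _; rewrite fundamental_tensorE.
    apply: (@smooth_onM _ _ _ oW (cst (2^-1 : R)) (dy (e a) (dy (e b) L))).
      exact: smooth_on_cst.
    by do 2 apply: smooth_dy; exact: smooth_energy.
  exact: fundamental_tensor_unitmx.
apply: smooth_onB => //; last by apply: smooth_dx; exact: smooth_energy.
apply: smooth_on_sum => // k _.
apply: (@smooth_onM _ _ _ oW (snd_coord k) (dx (e k) (dy (e l) L))).
  exact: smooth_snd_coord.
by apply: smooth_dx; apply: smooth_dy; exact: smooth_energy.
Qed.

(** As [4 g = 2 L_yy], the definition through [invmx] amounts to this linear system, of which the
    spray is the only solution. To identify the spray it is then enough to exhibit a solution. *)
Lemma spray_eqP p (s : 'I_n -> R) : W p ->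
  (forall l, spray_rhs F l p = 2 * \sum_(i < n) s i * dy (e l) (dy (e i) L) p) <->
  (forall i, spray_coef F i p = s i).
Proof.
move=> Wp; have uM := fundamental_tensor_unitmx Wp.
set g := fundamental_tensor F p.1 p.2 in uM *.
have gE l i : g l i = 2^-1 * dy (e l) (dy (e i) L) p.
  by case: p {Wp uM} @g => x y g; rewrite /g fundamental_tensorE.
pose c : 'cV[R]_n := \col_l spray_rhs F l p.
pose sc : 'cV[R]_n := \col_i spray_coef F i p.
have scE : sc = 4^-1 *: (invmx g *m c).
  apply/colP => i; rewrite !mxE spray_coefE; apply: mulr_congr => //.
  by apply: eq_bigr => l _; rewrite mxE.
have cE : c = 4 *: (g *m sc).
  by rewrite scE -scalemxAr scalerA divff ?scale1r ?mulKVmx// pnatr_eq0.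
have mulE (t : 'I_n -> R) l : (4 *: (g *m \col_i t i)) l ord0 =
    2 * \sum_(i < n) t i * dy (e l) (dy (e i) L) p.
  rewrite [LHS]mxE [X in _ * X]mxE mulr_sumr [RHS]mulr_sumr; apply: eq_bigr => i _.
  by rewrite gE [(\col_ _ _) _ _]mxE; field.
split=> [H i|H l].
  have cs : c = 4 *: (g *m \col_i s i).
    by apply/colP => l; rewrite mulE -H mxE.
  have : sc = \col_i s i.
    by rewrite scE cs -scalemxAr mulKmx// scalerA mulVf ?scale1r// pnatr_eq0.
  by move/colP/(_ i); rewrite !mxE.
rewrite -mulE.
have -> : \col_i s i = sc by apply/colP => i; rewrite !mxE H.
by rewrite -cE mxE.
Qed.

Lemma spray_eq p l : W p ->
  spray_rhs F l p = 2 * \sum_(i < n) spray_coef F i p * dy (e l) (dy (e i) L) p.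
Proof. by move=> Wp; apply: (spray_eqP (spray_coef F ^~ p) Wp).2 => i. Qed.

Definition homogeneous (d : nat) G := forall x y (a : R), Omega x -> y != 0 -> 0 < a ->
  G (x, a *: y) = a ^+ d * G (x, y).

Lemma near_slit p (w : V * V) : W p -> \forall t \near (0 : R), W (p + t *: w).
Proof.
move=> Wp.
have [dl _] := is_derive_line p w 0.
have cl : {for (0 : R), continuous (fun t : R => p + t *: w)}.
  by apply: differentiable_continuous; apply/derivable1_diffP.
have Wl : nbhs (p + (0 : R) *: w) W by rewrite scale0r addr0; exact: open_nbhs_nbhs.
exact: cl Wl.
Qed.

Lemma homogeneous_dx d w G : smooth_on W G -> homogeneous d G -> homogeneous d (dx w G).
Proof.
rewrite dx.unlock => sG hG x y a Ox y0 a0.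
have Wxy : W (x, y) by [].
have Wxay : W (x, a *: y) by split; rewrite //= scaler_eq0 negb_or gt_eqF.
apply: derive_along; [exact: (smooth_on_differentiable sG)..|].
have := near_slit (w, 0) Wxy; apply: filterS => t [/= Ot _].
have E y' : (x, y') + t *: ((w, 0) : V * V) = (x + t *: w, y').
  by congr pair; rewrite /= scaler0 addr0.
by rewrite !E hG.
Qed.

(** Moving from [a y] along [a w] is the dilation by [a] of moving from [y] along [w]; cancelling
    the factor [a] of the direction lowers the degree by one. *)
Lemma homogeneous_dy d w G : smooth_on W G -> homogeneous d.+1 G -> homogeneous d (dy w G).
Proof.
rewrite dy.unlock => sG hG x y a Ox y0 a0.
have Wxy : W (x, y) by [].
have Wxay : W (x, a *: y) by split; rewrite //= scaler_eq0 negb_or gt_eqF.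
apply: (@mulfI _ a); first by rewrite gt_eqF.
rewrite mulrA -exprS -derive_dirZ; last exact: (smooth_on_differentiable sG).
apply: derive_along; [exact: (smooth_on_differentiable sG)..|].
have := near_slit (0, w) Wxy; apply: filterS => t [/= _ yt].
have E y' w' : (x, y') + t *: ((0, w') : V * V) = (x, y' + t *: w').
  by congr pair; rewrite /= scaler0 addr0.
have Ea : a *: ((0, w) : V * V) = (0, a *: w) by congr pair; rewrite /= scaler0.
by rewrite Ea !E -hG// scalerDr !scalerA mulrC.
Qed.

(** Derivative at [t = 0] of [G (x, (1 + t) y)], which is [(1 + t)^d G (x, y)] as soon as
    [t > -1]. *)
Lemma euler d G x y : smooth_on W G -> homogeneous d G -> Omega x -> y != 0 ->
  dy y G (x, y) = d%:R * G (x, y).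
Proof.
rewrite dy.unlock => sG hG Ox y0; have Wxy : W (x, y) by [].
have D1 : is_derive (0 : R) (1 : R) (G \o (fun t => (x, y) + t *: ((0, y) : V * V))) ('D_((0, y) : V * V) (G : _ -> R^o) (x, y)).
  have := @is_derive_curve R _ G (fun t => (x, y) + t *: ((0, y) : V * V)) 0 (0, y) (is_derive_line _ _ 0).
  by rewrite scale0r addr0; apply; exact: (smooth_on_differentiable sG).
have D0 : is_derive (0 : R) (1 : R) (cst (1 : R) + id) (0 + 1 : R).
  by apply: is_deriveD.
have D2 := is_deriveZ (G (x, y)) (is_deriveX d D0).
have E : \forall t \near (0 : R),
    (G \o (fun t => (x, y) + t *: ((0, y) : V * V))) t = (G (x, y) \*: ((cst 1 + id) ^+ d)) t.
  have : \forall t \near (0 : R), (-1 : R) < t by apply: lt_nbhsr; rewrite ltrN10.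
  apply: filterS => t t1.
  have -> : (G (x, y) \*: ((cst 1 + id) ^+ d)) t = G (x, y) * (1 + t) ^+ d.
    by rewrite /= exprfctE.
  rewrite mulrC -hG//; last by rewrite -ltrBlDl sub0r.
  by congr (G _); congr pair => /=; rewrite ?scaler0 ?addr0// scalerDl scale1r.
have [_ <-] := near_eq_is_derive E D1.
have [_ ->] := D2.
have -> : (cst (1 : R) + id) (0 : R) = 1 by exact: addr0.
by rewrite /GRing.scale/= expr1n; ring.
Qed.


Lemma homogeneous_energy : homogeneous 2 L.
Proof.
by have [_ hF _ _] := finslerF; move=> x y a Ox y0 a0; rewrite /energy/= hF// exprMn.
Qed.

(** By uniqueness in the linear system: [a^2 G^i (x, y)] solves the system at [(x, a y)]. *)
Lemma homogeneous_spray i : homogeneous 2 (spray_coef F i).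
Proof.
move=> x y a Ox y0 a0.
have Wxy : W (x, y) by [].
have Wxay : W (x, a *: y) by split; rewrite //= scaler_eq0 negb_or gt_eqF.
apply: (spray_eqP (fun i => a ^+ 2 * spray_coef F i (x, y)) Wxay).1 => l {i}.
have sL := smooth_energy; have hL := homogeneous_energy.
have -> : spray_rhs F l (x, a *: y) = a ^+ 2 * spray_rhs F l (x, y).
  rewrite /spray_rhs mulrBr; apply: subr_congr => //; last exact: homogeneous_dx.
  rewrite mulr_sumr; apply: eq_bigr => k _ /=.
  have -> : dx (e k) (dy (e l) L) (x, a *: y) = a ^+ 1 * dx (e k) (dy (e l) L) (x, y).
    by apply: homogeneous_dx => //; [exact: smooth_dy|exact: homogeneous_dy].
  by rewrite mxE; ring.
rewrite spray_eq// mulrCA; apply: mulr_congr => //; rewrite mulr_sumr; apply: eq_bigr => i _.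
have -> : dy (e l) (dy (e i) L) (x, a *: y) = a ^+ 0 * dy (e l) (dy (e i) L) (x, y).
  by apply: homogeneous_dy => //; [exact: smooth_dy|exact: homogeneous_dy].
by rewrite expr0; ring.
Qed.




Lemma dy_spray_rhs m l p : W p -> dy (e m) (spray_rhs F l) p =
  dx (e m) (dy (e l) L) p
  + \sum_(k < n) p.2 ord0 k * dx (e k) (dy (e m) (dy (e l) L)) p
  - dx (e l) (dy (e m) L) p.
Proof.
move=> Wp; have sL := smooth_energy.
have sk k : smooth_on W (dx (e k) (dy (e l) L)) by apply: smooth_dx; exact: smooth_dy.
have sc k : smooth_on W (@snd_coord R n k) by exact: smooth_snd_coord.
have -> : dy (e m) (spray_rhs F l) p =
    dy (e m) (fun q => \sum_(k < n) snd_coord k q * dx (e k) (dy (e l) L) q) p -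
    dy (e m) (dx (e l) L) p.
  by apply: (@dyB _ _ W) => //; [exact: smooth_on_sum_mul|exact: smooth_dx].
rewrite (dxyC oW (e l) (e m) sL Wp).
rewrite (@dy_sum_mul _ _ W (e m) (@snd_coord R n) (fun k => dx (e k) (dy (e l) L)) p sc sk Wp).
rewrite (bigD1 m)//= dy_snd_coord eqxx mul1r big1 ?addr0; last first.
  by move=> k km; rewrite dy_snd_coord (negbTE km) mul0r.
apply: subr_congr => //; apply: addr_congr => //; apply: eq_bigr => k _.
by rewrite snd_coordE (dxyC oW (e k) (e m) (smooth_dy (e l) sL) Wp).
Qed.

Lemma dy_spray_lhs m l p : W p ->
  dy (e m) (fun q => 2 * \sum_(i < n) spray_coef F i q * dy (e l) (dy (e i) L) q) p =
  2 * (\sum_(i < n) dy (e m) (spray_coef F i) p * dy (e l) (dy (e i) L) p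
    + \sum_(i < n) spray_coef F i p * dy (e m) (dy (e l) (dy (e i) L)) p).
Proof.
move=> Wp; have sL := smooth_energy.
have sk k : smooth_on W (dy (e l) (dy (e k) L)) by do 2 apply: smooth_dy.
have ss k := smooth_spray k.
rewrite -(@dy_sum_mul _ _ W (e m) (spray_coef F) (fun k => dy (e l) (dy (e k) L)) p ss sk Wp).
exact: (@dyZ _ _ W (e m) 2 _ p (smooth_on_sum_mul oW ss sk) Wp).
Qed.

(* F is constant along the horizontal curves of its canonical connection: differentiate the spray
   equation in y^m, antisymmetrise in (l, m) and contract with y^l. *)
Lemma energy_horizontal m p : W p ->
  dx (e m) L p = \sum_(i < n) dy (e m) (spray_coef F i) p * dy (e i) L p.
Proof.
move=> Wp; have sL := smooth_energy; have hL := homogeneous_energy.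
case: p Wp => x y Wxy; have [/= Ox y0] := Wxy.
(* Together with the sum of third y-derivatives of [L], this is the part symmetric in the two
   indices; both drop out of the difference formed in [A]. *)
pose T a b := \sum_(k < n) y ord0 k * dx (e k) (dy (e a) (dy (e b) L)) (x, y).
have Tsym a b : T a b = T b a.
  apply: eq_bigr => k _; apply: mulr_congr => //; apply: (eq_dx oW) => // q Wq; exact: (dyC oW).
have D a b : dx (e a) (dy (e b) L) (x, y) + T a b - dx (e b) (dy (e a) L) (x, y) =
   2 * (\sum_(i < n) dy (e a) (spray_coef F i) (x, y) * dy (e b) (dy (e i) L) (x, y)
    + \sum_(i < n) spray_coef F i (x, y) * dy (e a) (dy (e b) (dy (e i) L)) (x, y)).
  rewrite -dy_spray_lhs// -dy_spray_rhs//; apply: (eq_dy oW) => // q Wq; exact: spray_eq.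
have A l : dx (e m) (dy (e l) L) (x, y) - dx (e l) (dy (e m) L) (x, y) =
   \sum_(i < n) dy (e m) (spray_coef F i) (x, y) * dy (e l) (dy (e i) L) (x, y)
   - \sum_(i < n) dy (e l) (spray_coef F i) (x, y) * dy (e m) (dy (e i) L) (x, y).
  have D1 := D m l; have D2 := D l m.
  rewrite Tsym in D2.
  have E3 : \sum_(i < n) spray_coef F i (x, y) * dy (e l) (dy (e m) (dy (e i) L)) (x, y) =
    \sum_(i < n) spray_coef F i (x, y) * dy (e m) (dy (e l) (dy (e i) L)) (x, y).
    by apply: eq_bigr => i _; apply: mulr_congr => //; apply: (dyC oW) => //; exact: smooth_dy.
  rewrite E3 in D2.
  move: D1 D2; set S1 := \sum_(i < n) _; set S2 := \sum_(i < n) _; set S3 := \sum_(i < n) _.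
  move: (dx _ _ _) (dx _ _ _) (T m l) => a b t D1 D2.
  by lra.
have Cdy G : smooth_on W G ->
    \sum_(l < n) y ord0 l * dy (e l) G (x, y) = dy y G (x, y).
  by move=> sG; rewrite -(dy_sum_basis y sG Wxy).
have EA : \sum_(l < n) (y ord0 l * dx (e m) (dy (e l) L) (x, y)
     - y ord0 l * dx (e l) (dy (e m) L) (x, y)) =
   \sum_(l < n) (y ord0 l *
       (\sum_(i < n) dy (e m) (spray_coef F i) (x, y) * dy (e l) (dy (e i) L) (x, y))
     - y ord0 l *
       (\sum_(i < n) dy (e l) (spray_coef F i) (x, y) * dy (e m) (dy (e i) L) (x, y))).
  by apply: eq_bigr => l _; rewrite -!mulrBr A.
have E1 : \sum_(l < n) y ord0 l * dx (e m) (dy (e l) L) (x, y) = 2 * dx (e m) L (x, y).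
  under eq_bigr => l _ do rewrite (dxyC oW (e m) (e l) sL Wxy).
  rewrite Cdy; last exact: smooth_dx.
  by apply: (euler (d := 2)) => //; [exact: smooth_dx|exact: homogeneous_dx].
(* This contraction is the spray equation itself. Its sum [2 G^i L_{y^m y^i}] also appears in [E4],
   by Euler's identity for the spray, of degree 2. The two cancel, and one of the two copies of
   [dx (e m) L] in [E1] survives. *)
have E2 : \sum_(l < n) y ord0 l * dx (e l) (dy (e m) L) (x, y) = dx (e m) L (x, y) +
    2 * \sum_(i < n) spray_coef F i (x, y) * dy (e m) (dy (e i) L) (x, y).
  by rewrite -spray_eq// /spray_rhs addrC subrK.
have E3 : \sum_(l < n) y ord0 l *
   \sum_(i < n) dy (e m) (spray_coef F i) (x, y) * dy (e l) (dy (e i) L) (x, y) =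
   \sum_(i < n) dy (e m) (spray_coef F i) (x, y) * dy (e i) L (x, y).
  under eq_bigr => l _ do rewrite mulr_sumr.
  rewrite exchange_big/=; apply: eq_bigr => i _.
  have -> : dy (e i) L (x, y) = \sum_(l < n) y ord0 l * dy (e l) (dy (e i) L) (x, y).
    rewrite Cdy; last exact: smooth_dy.
    rewrite (@euler 1)// ?mul1r//; [exact: smooth_dy|exact: homogeneous_dy].
  by rewrite mulr_sumr; apply: eq_bigr => l _; rewrite mulrCA.
have E4 : \sum_(l < n) y ord0 l *
   \sum_(i < n) dy (e l) (spray_coef F i) (x, y) * dy (e m) (dy (e i) L) (x, y) =
   2 * \sum_(i < n) spray_coef F i (x, y) * dy (e m) (dy (e i) L) (x, y).
  under eq_bigr => l _ do rewrite mulr_sumr.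
  rewrite exchange_big/= mulr_sumr; apply: eq_bigr => i _.
  rewrite mulrA -(@euler 2 _ _ _ (smooth_spray i) (homogeneous_spray i) Ox y0).
  rewrite -Cdy; last exact: smooth_spray.
  by rewrite mulr_suml; apply: eq_bigr => l _; rewrite mulrA.
move: EA; rewrite !sumrB E1 E2 E3 E4.
move: (dx _ _ _) (\sum_(i < n) _) (\sum_(i < n) _) => a b c H.
lra.
Qed.

End FinslerMetric.

(** * Rotational symmetry *)

Section Euclidean.
Context {R : realType} {n : nat}.
Local Notation V := 'rV[R]_n.
Implicit Types (x y z u v w : V) (a b : R).

Lemma dotC x y : dot x y = dot y x.
Proof. by apply: eq_bigr => i _; rewrite mulrC. Qed.

Lemma dotDl x y z : dot (x + y) z = dot x z + dot y z.
Proof. by rewrite -big_split/=; apply: eq_bigr => i _; rewrite mxE mulrDl. Qed.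

Lemma dotZl a x z : dot (a *: x) z = a * dot x z.
Proof. by rewrite mulr_sumr; apply: eq_bigr => i _; rewrite mxE mulrA. Qed.

Lemma dotDr x y z : dot x (y + z) = dot x y + dot x z.
Proof. by rewrite dotC dotDl !(dotC x). Qed.

Lemma dotZr a x z : dot x (a *: z) = a * dot x z.
Proof. by rewrite dotC dotZl dotC. Qed.

Lemma dotNl x z : dot (- x) z = - dot x z.
Proof. by rewrite -scaleN1r dotZl mulN1r. Qed.

Lemma dotNr x z : dot x (- z) = - dot x z.
Proof. by rewrite dotC dotNl dotC. Qed.

Lemma dot0l z : dot 0 z = 0.
Proof. by rewrite -(scale0r 0) dotZl mul0r. Qed.

Lemma dot0r z : dot z 0 = 0. Proof. by rewrite dotC dot0l. Qed.

Definition dotE := (dotDl, dotDr, dotZl, dotZr, dotNl, dotNr, dot0l, dot0r).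

Lemma dot_ge0 x : 0 <= dot x x.
Proof. by apply: sumr_ge0 => i _; rewrite -expr2 sqr_ge0. Qed.

Lemma dot_eq0 x : (dot x x == 0) = (x == 0).
Proof.
apply/eqP/eqP => [|->]; last by rewrite dot0l.
move=> /eqP; rewrite psumr_eq0; last by move=> i _; rewrite -expr2 sqr_ge0.
move=> /allP H; apply/rowP => i; rewrite mxE.
by have := H i (mem_index_enum _); rewrite /= mulf_eq0 orbb => /eqP.
Qed.

Lemma dot_gt0 x : x != 0 -> 0 < dot x x.
Proof. by move=> x0; rewrite lt_neqAle dot_ge0 eq_sym dot_eq0 x0. Qed.

Lemma enorm_sqr x : enorm x ^+ 2 = dot x x.
Proof. by rewrite sqr_sqrtr// dot_ge0. Qed.

Lemma enorm_gt0 x : x != 0 -> 0 < enorm x.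
Proof. by move=> x0; rewrite sqrtr_gt0 dot_gt0. Qed.

Lemma enormZ a x : 0 <= a -> enorm (a *: x) = a * enorm x.
Proof.
move=> a0; rewrite /enorm dotZl dotZr mulrA -expr2 sqrtrM ?sqr_ge0//.
by rewrite sqrtr_sqr ger0_norm.
Qed.

Lemma enorm_unit v : dot v v = 1 -> enorm v = 1.
Proof. by rewrite /enorm => ->; rewrite sqrtr1. Qed.

Lemma unit_neq0 v : dot v v = 1 -> v != 0.
Proof. by rewrite -dot_eq0 => ->; rewrite oner_eq0. Qed.

(** The column [x^T] has rank at most 1, which is less than n, so its kernel contains a nonzero
    vector; this covers [x = 0] too. *)
Lemma exists_orthonormal x : (2 <= n)%N -> exists2 v, dot v v = 1 & dot x v = 0.
Proof.
move=> n2.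
have [v vx v0] : exists2 v : V, dot x v = 0 & v != 0.
  have : kermx (x^T) != 0.
    rewrite kermx_eq0 /row_free; apply/negP => /eqP E.
    by have := rank_leq_col x^T; rewrite E leqNgt n2.
  move=> /rowV0Pn[v /sub_kermxP vx v0]; exists v => //.
  by move/matrixP/(_ ord0 ord0): vx; rewrite !mxE => <-; apply: eq_bigr => i _; rewrite mxE mulrC.
exists ((enorm v)^-1 *: v); last by rewrite dotZr vx mulr0.
rewrite dotZl dotZr -enorm_sqr expr2 mulrA mulrA -mulrA -invfM.
by rewrite mulVf// mulf_neq0// gt_eqF// enorm_gt0.
Qed.

Lemma polar_decomposition x : x != 0 -> exists r e,
  [/\ 0 < r, dot e e = 1, x = r *: e & enorm x = r].
Proof.
move=> x0; have r0 := enorm_gt0 x0; have r1 : enorm x != 0 by rewrite gt_eqF.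
exists (enorm x), ((enorm x)^-1 *: x); split=> //.
  by rewrite dotZl dotZr -enorm_sqr expr2; field.
by rewrite scalerA divff ?scale1r.
Qed.

(** For a unit vector [u], the reflection in the hyperplane orthogonal to [u]. Its determinant is
    -1, so its effect on [F] is read off the radial form, which depends on inner products only. *)
Definition reflection u y : V := y - (2 * dot y u) *: u.

Lemma reflection_dot u x y : dot u u = 1 -> dot (reflection u x) (reflection u y) = dot x y.
Proof. by move=> u1; rewrite /reflection !dotE u1 (dotC u y); ring. Qed.

Lemma reflectionD u x y : reflection u (x + y) = reflection u x + reflection u y.
Proof. by rewrite /reflection dotDl mulrDr scalerDl opprD addrACA. Qed.

Lemma reflectionZ u a x : reflection u (a *: x) = a *: reflection u x.
Proof. by rewrite /reflection dotZl scalerBr scalerA mulrCA. Qed.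

Lemma reflection_id u y : dot y u = 0 -> reflection u y = y.
Proof. by move=> yu; rewrite /reflection yu mulr0 scale0r subr0. Qed.

Lemma reflection_self u : dot u u = 1 -> reflection u u = - u.
Proof. by move=> u1; rewrite /reflection u1 mulr1 scaler_nat mulr2n opprD addrA subrr add0r. Qed.

Lemma reflection_neq0 u y : dot u u = 1 -> y != 0 -> reflection u y != 0.
Proof. by move=> u1; rewrite -!dot_eq0 reflection_dot. Qed.

End Euclidean.

Section Curves.
Context {R : realType}.

Lemma is_derive_pair (V1 V2 : normedModType R) (c1 : R -> V1) (c2 : R -> V2) t d1 d2 :
  is_derive t (1 : R) c1 d1 -> is_derive t (1 : R) c2 d2 ->
  is_derive t (1 : R) (fun s => (c1 s, c2 s)) (d1, d2).
Proof.
move=> [/derivable1_diffP dc1 E1] [/derivable1_diffP dc2 E2].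
have dc : differentiable (fun s => (c1 s, c2 s)) t by exact: differentiable_pair.
split; first exact/derivable1_diffP.
by rewrite deriveE// diff_pair// -E1 -E2 (deriveE _ dc1) (deriveE _ dc2).
Qed.

Lemma is_derive_scalev (V : normedModType R) (a : R -> R) (v : V) t da :
  is_derive t (1 : R) a da -> is_derive t (1 : R) (fun s => a s *: v) (da *: v).
Proof.
move=> [/derivable1_diffP dat E].
have dc : differentiable (fun s => a s *: v) t by exact: differentiableZl.
split; first exact/derivable1_diffP.
by rewrite deriveE// diffZl// -E (deriveE _ dat).
Qed.

End Curves.

Section Symmetries.
Context {R : realType} {n : nat}.
Local Notation V := 'rV[R]_n.
Variables (Omega : set V) (F : V -> V -> R) (phi : R -> R -> R).
Hypothesis openO : open Omega.
Hypothesis finslerF : finsler_metric Omega F.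
Hypothesis Fphi : radial_form Omega F phi.
Local Notation W := (slit Omega).
Local Notation L := (energy F).
Implicit Types (x y u v w e : V) (p q : V * V).

Let oW : open W. Proof. exact: open_slit. Qed.
Let sL : smooth_on W L. Proof. exact: smooth_energy. Qed.

Lemma energy_differentiable p : W p -> differentiable (L : V * V -> R^o) p.
Proof. by move=> Wp; exact: smooth_on_differentiable Wp. Qed.

Lemma energy_invariant x y x' y' : Omega x -> Omega x' -> y != 0 -> y' != 0 ->
  dot x x = dot x' x' -> dot y y = dot y' y' -> dot x y = dot x' y' ->
  L (x, y) = L (x', y').
Proof.
move=> Ox Ox' y0 y0' xx yy xy; rewrite /energy/=.
have [_ ->] := Fphi Ox y0; have [_ ->] := Fphi Ox' y0'.
by rewrite /svar /enorm xx yy xy.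
Qed.

Section AtPoint.
Variables (r : R) (e : V).
Hypotheses (r0 : 0 < r) (e1 : dot e e = 1) (Ore : Omega (r *: e)).

Let slit_re y : y != 0 -> W (r *: e, y). Proof. by []. Qed.

(** As [u] is orthogonal to [e], the reflection fixes the base point [r e]. It sends the line
    through [(r e, y)] in direction [(w1, w2)] to a line on which [L] takes the same values. *)
Lemma energy_reflection u y w1 w2 : dot u u = 1 -> dot e u = 0 -> y != 0 ->
  'D_((reflection u w1, reflection u w2) : V * V) (L : V * V -> R^o) (r *: e, reflection u y) =
  'D_((w1, w2) : V * V) (L : V * V -> R^o) (r *: e, y).
Proof.
move=> u1 eu y0; have ry0 := reflection_neq0 u1 y0.
rewrite -[RHS]mul1r; apply: derive_along.
- exact: energy_differentiable (slit_re ry0).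
- exact: energy_differentiable (slit_re y0).
have N1 := near_slit openO (w1, w2) (slit_re y0).
have N2 := near_slit openO (reflection u w1, reflection u w2) (slit_re ry0).
near=> t; rewrite mul1r.
have [/= O1 n1] : W ((r *: e, y) + t *: ((w1, w2) : V * V)) by near: t; exact: N1.
have [/= O2 n2] : W ((r *: e, reflection u y) + t *: ((reflection u w1, reflection u w2) : V * V)).
  by near: t; exact: N2.
have E1 : r *: e + t *: reflection u w1 = reflection u (r *: e + t *: w1).
  by rewrite reflectionD !reflectionZ (reflection_id eu).
have E2 : reflection u y + t *: reflection u w2 = reflection u (y + t *: w2).
  by rewrite reflectionD reflectionZ.
by apply: energy_invariant => //; rewrite ?E1 ?E2 reflection_dot.
Unshelve. all: by end_near. Qed.

Lemma dx_energy_reflection u y w : dot u u = 1 -> dot e u = 0 -> y != 0 ->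
  dx (reflection u w) L (r *: e, reflection u y) = dx w L (r *: e, y).
Proof.
move=> u1 eu y0; rewrite dx.unlock -(energy_reflection w 0 u1 eu y0).
by rewrite [reflection u 0]reflection_id// dot0l.
Qed.

Lemma dy_energy_reflection u y w : dot u u = 1 -> dot e u = 0 -> y != 0 ->
  dy (reflection u w) L (r *: e, reflection u y) = dy w L (r *: e, y).
Proof.
move=> u1 eu y0; rewrite dy.unlock -(energy_reflection 0 w u1 eu y0).
by rewrite [reflection u 0]reflection_id// dot0l.
Qed.

(* The curve is the orbit of (r e, y) under the rotations of the plane spanned by e and v. *)
Lemma dx_energy_rotation v y : dot v v = 1 -> dot e v = 0 -> y != 0 ->
  r * dx v L (r *: e, y) = - dy (dot y e *: v - dot y v *: e) L (r *: e, y).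
Proof.
move=> v1 ev y0; set p := dot y e; set q := dot y v.
have dL := energy_differentiable (slit_re y0).
pose c1 (t : R) : V := cos t *: (r *: e) + sin t *: (r *: v).
(* Only the components [(p, q)] of [y] in the plane are turned by the angle [t]; the part of [y]
   orthogonal to the plane stays. *)
pose c2 (t : R) : V := y + (p * (cos t - 1) - q * sin t) *: e
  + (p * sin t + q * (cos t - 1)) *: v.
pose c t := (c1 t, c2 t).
have dc1 : is_derive (0 : R) (1 : R) c1 (r *: v).
  have := is_deriveD (is_derive_scalev (r *: e) (is_derive_cos 0))
    (is_derive_scalev (r *: v) (is_derive_sin 0)).
  by rewrite sin0 cos0 oppr0 scale0r add0r scale1r.
have dcos : is_derive (0 : R) (1 : R) (fun t : R => cos t - 1) 0.
  have := is_deriveB (is_derive_cos (0 : R)) (is_derive_cst (1 : R) (0 : R) (1 : R)).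
  by rewrite sin0 oppr0 addr0.
have dsin : is_derive (0 : R) (1 : R) (@sin R) 1.
  by have := is_derive_sin (0 : R); rewrite cos0.
have dc2 : is_derive (0 : R) (1 : R) c2 (p *: v - q *: e).
  have Ha : is_derive (0 : R) (1 : R) (fun t => p * (cos t - 1) - q * sin t) (p * 0 - q * 1).
    exact: (is_deriveB (is_deriveZ p dcos) (is_deriveZ q dsin)).
  have Hb : is_derive (0 : R) (1 : R) (fun t => p * sin t + q * (cos t - 1)) (p * 1 + q * 0).
    exact: (is_deriveD (is_deriveZ p dsin) (is_deriveZ q dcos)).
  have H := is_deriveD (is_deriveD (is_derive_cst y (0 : R) (1 : R)) (is_derive_scalev e Ha))
    (is_derive_scalev v Hb).
  apply: (is_derive_eq H).
  by rewrite !mulr0 !mulr1 !(add0r, addr0) scaleNr addrC.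
have c0 : c 0 = (r *: e, y).
  rewrite /c /c1 /c2 sin0 cos0 subrr !mulr0 subr0 addr0 !scale0r !addr0 scale1r.
  by [].
have dc : is_derive (0 : R) (1 : R) c (r *: v, p *: v - q *: e) by exact: is_derive_pair.
have dcc : differentiable c 0 by apply/derivable1_diffP; have [] := dc.
have nW : \forall t \near (0 : R), W (c t).
  have cc : {for (0 : R), continuous c} by exact: differentiable_continuous.
  have Wc : nbhs (c 0) W by rewrite c0; exact: open_nbhs_nbhs.
  exact: cc Wc.
have cst_L : \forall t \near (0 : R), L (c t) = L (r *: e, y).
  apply: filterS nW => t [/= O1 n1].
  have cs := cos2Dsin2 t.
  have [ve yv ye] : [/\ dot v e = 0, dot v y = q & dot e y = p] by rewrite !(dotC _ y) dotC.
  apply: energy_invariant => //; rewrite /c1 /c2 !dotE ?ev ?ve ?e1 ?v1 ?yv ?ye.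
  - rewrite -[RHS]mulr1 -[X in _ = _ * X]cs; ring.
  - rewrite -/p -/q.
    apply/eqP; rewrite -subr_eq0; apply/eqP.
    transitivity ((p ^+ 2 + q ^+ 2) * (cos t ^+ 2 + sin t ^+ 2 - 1)); first by ring.
    by rewrite cs subrr mulr0.
  - rewrite -[RHS]mulr1 -[X in _ = _ * X]cs; ring.
have := derive_curve_eq0 dc (t := 0) _ cst_L.
rewrite c0 => /(_ dL).
have -> : ((r *: v, p *: v - q *: e) : V * V) = r *: ((v, 0) : V * V) + (0, p *: v - q *: e).
  by congr pair; rewrite /= ?addr0// scaler0 add0r.
rewrite (derive_dirD dL) (derive_dirZ dL) => /eqP; rewrite addr_eq0 => /eqP.
by rewrite dx.unlock dy.unlock.
Qed.

End AtPoint.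

End Symmetries.

(** * Berwald metrics at a point *)

Section SlitCurves.
Context {R : realType} {n : nat}.
Local Notation V := 'rV[R]_n.
Variable Omega : set V.
Hypothesis openO : open Omega.
Local Notation W := (slit Omega).
Implicit Types (G : V * V -> R) (x y u v w e : V) (p q : V * V).

Lemma is_derive_vertical G x y w (t : R) : smooth_on W G -> Omega x -> y + t *: w != 0 ->
  is_derive t (1 : R) (fun s : R => G (x, y + s *: w)) (dy w G (x, y + t *: w)).
Proof.
move=> sG Ox y0; rewrite dy.unlock.
have E s : (x, y) + s *: ((0, w) : V * V) = (x, y + s *: w).
  by congr pair; rewrite /= scaler0 addr0.
have := @is_derive_curve R _ G (fun s => (x, y) + s *: ((0, w) : V * V)) t (0, w)
  (is_derive_line _ _ t).
rewrite E; have -> : G \o (fun s => (x, y) + s *: ((0, w) : V * V)) = (fun s => G (x, y + s *: w)).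
  by apply/funext => s /=; rewrite E.
by apply; exact: smooth_on_differentiable sG _.
Qed.

Lemma continuous_vertical G x y w (t : R) : smooth_on W G -> Omega x -> y + t *: w != 0 ->
  {for t, continuous (fun s : R => G (x, y + s *: w))}.
Proof.
move=> sG Ox y0; apply: differentiable_continuous; apply/derivable1_diffP.
by have [] := is_derive_vertical sG Ox y0.
Qed.

Lemma near_continuous_eq0 (f : R -> R) (a : R) : {for a, continuous f} ->
  (\forall t \near a, t != a -> f t = 0) -> f a = 0.
Proof.
move=> cf f0; apply/eqP/negPn/negP => fa0.
have fa : 0 < `|f a| by rewrite normr_gt0.
have Nf : \forall t \near a, `|f a - f t| < `|f a| by move/cvgrPdist_lt : cf => /(_ _ fa).
have [d /= d0 H] := (nbhs_ballP _ _).1 (filterI Nf f0).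
have ne : a + d / 2 != a by rewrite -subr_eq0 addrAC subrr add0r gt_eqF// divr_gt0.
have [] := H (a + d / 2).
  by rewrite /ball/= opprD addrA subrr add0r normrN gtr0_norm ?divr_gt0//; lra.
by move=> /= H1 H2; move: H1; rewrite (H2 ne) subr0 ltxx.
Qed.

Lemma continuous_eq0 (f : R -> R) (a : R) : {for a, continuous f} ->
  (forall t, t != a -> f t = 0) -> f a = 0.
Proof. by move=> cf f0; apply: near_continuous_eq0 => //; apply: filterE => t; exact: f0. Qed.

(** The mean value theorem on the segment, which must avoid 0 since the domain of [y] is not
    convex. *)
Lemma constant_on_segment G x y1 y2 : smooth_on W G -> Omega x ->
  (forall y k, y != 0 -> dy (basis_vec R k) G (x, y) = 0) ->
  (forall t : R, 0 <= t <= 1 -> y1 + t *: (y2 - y1) != 0) ->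
  G (x, y1) = G (x, y2).
Proof.
move=> sG Ox G0 seg.
have D (t : R) : t \in `[0, 1]%R ->
    is_derive t (1 : R) (fun s : R => G (x, y1 + s *: (y2 - y1))) 0.
  rewrite in_itv/= => tI; have yt := seg t tI.
  have <- : dy (y2 - y1) G (x, y1 + t *: (y2 - y1)) = 0.
    by rewrite (dy_sum_basis _ sG)// big1// => k _; rewrite G0// mulr0.
  exact: is_derive_vertical.
pose f (s : R) : R := G (x, y1 + s *: (y2 - y1)).
have D' (t : R) : t \in `]0, 1[%R -> is_derive t (1 : R) f ((fun=> 0) t).
  by move=> tI; apply: D; exact: subset_itv_oo_cc tI.
have C : {within `[0, 1], continuous f}.
  by apply: derivable_within_continuous => t tI; have [] := D t tI.
have [c _ E] := MVT_segment ler01 D' C.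
have f1 : f 1 = G (x, y2) by rewrite /f scale1r addrC subrK.
have f0 : f 0 = G (x, y1) by rewrite /f scale0r addr0.
by move: E; rewrite f0 f1 mul0r => /eqP; rewrite subr_eq0 => /eqP.
Qed.

Lemma dy_dirD u w G p : smooth_on W G -> W p -> dy (u + w) G p = dy u G p + dy w G p.
Proof.
rewrite dy.unlock => sG Wp; have dG := smooth_on_differentiable sG Wp.
by rewrite -(derive_dirD dG); congr (derive _ _ _); congr pair; rewrite addr0.
Qed.

Lemma dy_dirZ (a : R) w G p : smooth_on W G -> W p -> dy (a *: w) G p = a * dy w G p.
Proof.
rewrite dy.unlock => sG Wp; have dG := smooth_on_differentiable sG Wp.
by rewrite -(derive_dirZ dG); congr (derive _ _ _); congr pair; rewrite scaler0.
Qed.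

Lemma dx_dirD u w G p : smooth_on W G -> W p -> dx (u + w) G p = dx u G p + dx w G p.
Proof.
rewrite dx.unlock => sG Wp; have dG := smooth_on_differentiable sG Wp.
by rewrite -(derive_dirD dG); congr (derive _ _ _); congr pair; rewrite addr0.
Qed.

Lemma dx_dirZ (a : R) w G p : smooth_on W G -> W p -> dx (a *: w) G p = a * dx w G p.
Proof.
rewrite dx.unlock => sG Wp; have dG := smooth_on_differentiable sG Wp.
by rewrite -(derive_dirZ dG); congr (derive _ _ _); congr pair; rewrite scaler0.
Qed.

Lemma dy_dirN w G p : smooth_on W G -> W p -> dy (- w) G p = - dy w G p.
Proof. by move=> sG Wp; rewrite -scaleN1r dy_dirZ// mulN1r. Qed.

Lemma dx_dirN w G p : smooth_on W G -> W p -> dx (- w) G p = - dx w G p.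
Proof. by move=> sG Wp; rewrite -scaleN1r dx_dirZ// mulN1r. Qed.

End SlitCurves.

Section Christoffel.
Context {R : realType} {n : nat}.
Local Notation V := 'rV[R]_n.
Implicit Types (Gam : 'I_n -> 'I_n -> 'I_n -> R) (u v w y : V).

Definition christoffel Gam u v : V :=
  \row_i \sum_(l < n) \sum_(m < n) u ord0 l * v ord0 m * Gam i l m.

Lemma christoffelDl Gam u v w :
  christoffel Gam (u + v) w = christoffel Gam u w + christoffel Gam v w.
Proof.
apply/rowP => i; rewrite !mxE -big_split/=; apply: eq_bigr => l _.
by rewrite -big_split/=; apply: eq_bigr => m _; rewrite mxE; ring.
Qed.

Lemma christoffelZl Gam a v w : christoffel Gam (a *: v) w = a *: christoffel Gam v w.
Proof.
apply/rowP => i; rewrite !mxE mulr_sumr; apply: eq_bigr => l _.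
by rewrite mulr_sumr; apply: eq_bigr => m _; rewrite mxE; ring.
Qed.

Lemma christoffelC Gam u v : (forall i l m, Gam i l m = Gam i m l) ->
  christoffel Gam u v = christoffel Gam v u.
Proof.
move=> S; apply/rowP => i; rewrite !mxE exchange_big/=; apply: eq_bigr => l _.
by apply: eq_bigr => m _; rewrite S mulrAC [v _ _ * _]mulrC mulrAC.
Qed.

End Christoffel.

(** * Berwald metrics on the plane of a radius and an orthogonal unit vector *)

Section BerwaldPlane.
Context {R : realType} {n : nat}.
Local Notation V := 'rV[R]_n.
Variables (Omega : set V) (F : V -> V -> R) (phi : R -> R -> R).
Hypothesis openO : open Omega.
Hypothesis finslerF : finsler_metric Omega F.
Hypothesis Fphi : radial_form Omega F phi.
Hypothesis berwaldF : berwald_metric Omega F.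
Local Notation W := (slit Omega).
Local Notation L := (energy F).
Implicit Types (x y u v w e : V) (p q : V * V).

Let oW : open W. Proof. exact: open_slit. Qed.
Let sL : smooth_on W L. Proof. exact: smooth_energy. Qed.

(** The second y-derivatives of the spray have zero y-derivatives, so they keep their value at [y0]
    along every segment from [y0] that avoids 0. Euler's identity for the first y-derivatives, of
    degree 1, then makes the coefficients in [energy_horizontal] linear in [y]. *)
Lemma berwald_connection x y0 : Omega x -> y0 != 0 ->
  exists2 Gam : 'I_n -> 'I_n -> 'I_n -> R, (forall i l m, Gam i l m = Gam i m l) &
  forall y w, y != 0 -> (forall t : R, 0 <= t <= 1 -> y0 + t *: (y - y0) != 0) ->
    dx w L (x, y) = dy (christoffel Gam y w) L (x, y).
Proof.
move=> Ox y00.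
pose Gam i l m := dy (basis_vec R l) (dy (basis_vec R m) (spray_coef F i)) (x, y0).
have ss i := smooth_spray openO finslerF i.
have sd i m : smooth_on W (dy (basis_vec R m) (spray_coef F i)) by exact: smooth_dy.
exists Gam => [i l m|y w yn0 seg]; first exact: (dyC oW).
have Wxy : W (x, y) by [].
have GamE i l m : Gam i l m = dy (basis_vec R l) (dy (basis_vec R m) (spray_coef F i)) (x, y).
  apply: (constant_on_segment (Omega := Omega)) => //; first exact: smooth_dy.
  by move=> y' k y'0; rewrite -berwald_curvatureE; exact: berwaldF.
rewrite (dx_sum_basis _ sL Wxy) (dy_sum_basis _ sL Wxy).
under eq_bigr => m _ do rewrite (energy_horizontal openO finslerF m Wxy) mulr_sumr.
rewrite exchange_big/=; apply: eq_bigr => i _; rewrite mxE exchange_big/= mulr_suml.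
apply: eq_bigr => m _; rewrite mulrA; congr (_ * _).
have -> : dy (basis_vec R m) (spray_coef F i) (x, y) =
    dy y (dy (basis_vec R m) (spray_coef F i)) (x, y).
  rewrite (@euler _ _ _ 1 _ _ _ (sd i m))// ?mul1r//.
  by apply: homogeneous_dy => //; exact: homogeneous_spray.
rewrite (dy_sum_basis _ (sd i m) Wxy) mulr_sumr; apply: eq_bigr => l _.
by rewrite GamE; ring.
Qed.

Section AtPoint.
Variables (r : R) (e v : V).
Hypotheses (r0 : 0 < r) (e1 : dot e e = 1) (v1 : dot v v = 1) (ev : dot e v = 0)
  (Ore : Omega (r *: e)).

Local Notation pt p q := (r *: e, p *: e + q *: v).

Let ve : dot v e = 0. Proof. by rewrite dotC. Qed.

Lemma plane_dot_e (p q : R) : dot (p *: e + q *: v) e = p.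
Proof. by rewrite !dotE e1 ve; ring. Qed.

Lemma plane_dot_v (p q : R) : dot (p *: e + q *: v) v = q.
Proof. by rewrite !dotE v1 ev; ring. Qed.

Lemma plane_dot (p q : R) : dot (p *: e + q *: v) (p *: e + q *: v) = p ^+ 2 + q ^+ 2.
Proof. by rewrite !dotE v1 ev e1 ve; ring. Qed.

Lemma plane_neq0 (p q : R) : (p != 0) || (q != 0) -> p *: e + q *: v != 0.
Proof.
move=> pq; apply/eqP => E; move: pq.
have p0 : p = 0 by rewrite -(plane_dot_e p q) E dot0l.
have q0 : q = 0 by rewrite -(plane_dot_v p q) E dot0l.
by rewrite p0 q0 eqxx.
Qed.

Lemma slit_plane (p q : R) : (p != 0) || (q != 0) -> W (pt p q).
Proof. by move=> pq; split=> //; exact: plane_neq0. Qed.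

Lemma reflection_plane (p q : R) :
  reflection v (p *: e + q *: v) = p *: e + (- q) *: v.
Proof.
rewrite reflectionD !reflectionZ (reflection_id ev) reflection_self//.
by rewrite scalerN scaleNr.
Qed.

(** The reflection along [z] fixes [r e] and the vector of the plane but reverses [z], so the
    derivative equals its own opposite. *)
Lemma dy_energy_orthogonal z (p q : R) : (p != 0) || (q != 0) ->
  dot z e = 0 -> dot z v = 0 -> dy z L (pt p q) = 0.
Proof.
move=> pq ze zv; have Wpq := slit_plane pq.
have [->|z0] := eqVneq z 0; first by rewrite -(scale0r 0) (dy_dirZ _ _ sL Wpq) mul0r.
have n0 : enorm z != 0 by rewrite gt_eqF// enorm_gt0.
pose u := (enorm z)^-1 *: z.
have u1 : dot u u = 1 by rewrite !dotE -enorm_sqr; field.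
have eu : dot e u = 0 by rewrite dotC !dotE ze mulr0.
have yu : dot (p *: e + q *: v) u = 0 by rewrite dotC !dotE ze zv; ring.
have H := dy_energy_reflection openO finslerF Fphi Ore u u1 eu (plane_neq0 pq).
rewrite (reflection_id yu) (reflection_self u1) (dy_dirN _ sL Wpq) in H.
have -> : z = enorm z *: u by rewrite scalerA divff// scale1r.
rewrite (dy_dirZ _ _ sL Wpq); suff -> : dy u L (pt p q) = 0 by rewrite mulr0.
by move: H; lra.
Qed.

Lemma dy_energy_plane u (p q : R) : (p != 0) || (q != 0) ->
  dy u L (pt p q) = dot u e * dy e L (pt p q) + dot u v * dy v L (pt p q).
Proof.
move=> pq; have Wpq := slit_plane pq.
pose z := u - dot u e *: e - dot u v *: v.
have E : dot u e *: e + dot u v *: v + z = u.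
  have -> : z = u - (dot u e *: e + dot u v *: v) by rewrite /z opprD addrA.
  by rewrite addrC subrK.
have ze : dot z e = 0 by rewrite /z !dotE e1 ve; ring.
have zv : dot z v = 0 by rewrite /z !dotE v1 ev; ring.
clearbody z; rewrite -[in LHS]E !(dy_dirD _ _ sL Wpq) !(dy_dirZ _ _ sL Wpq).
by rewrite (dy_energy_orthogonal pq ze zv) addr0.
Qed.

Lemma dx_energy_plane_v (p q : R) : (p != 0) || (q != 0) ->
  r * dx v L (pt p q) = q * dy e L (pt p q) - p * dy v L (pt p q).
Proof.
move=> pq; have Wpq := slit_plane pq; have y0 := plane_neq0 pq.
rewrite (dx_energy_rotation openO finslerF Fphi e1 Ore v1 ev y0) plane_dot_e plane_dot_v.
rewrite (dy_dirD _ _ sL Wpq) (dy_dirN _ sL Wpq) !(dy_dirZ _ _ sL Wpq); ring.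
Qed.

Lemma euler_plane (p q : R) : (p != 0) || (q != 0) ->
  p * dy e L (pt p q) + q * dy v L (pt p q) = 2 * L (pt p q).
Proof.
move=> pq; have y0 := plane_neq0 pq.
rewrite -(@euler _ _ _ 2 _ _ _ sL (homogeneous_energy finslerF) Ore y0).
by rewrite (dy_energy_plane (p *: e + q *: v) pq) plane_dot_e plane_dot_v.
Qed.

(* [kappa = lambda = 0] is the case of a connection that is tangent to the rotations. *)
Lemma berwald_plane : exists kappa lambda mu : R, forall p q : R, q != 0 ->
  q * dy e L (pt p q) * kappa = p * dy v L (pt p q) * lambda /\
  dx e L (pt p q) = mu * (p * dy e L (pt p q)) + (lambda - r^-1) * (q * dy v L (pt p q)).
Proof.
have rn0 : r != 0 by rewrite gt_eqF.
have [Gam Gsym HGam] := berwald_connection Ore (unit_neq0 e1).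
pose B := christoffel Gam.
have Bve : B v e = B e v by exact: christoffelC.
exists (r^-1 - dot (B v v) e), (r^-1 + dot (B e v) v), (dot (B e e) e) => p q q0.
have pq : (p != 0) || (q != 0) by rewrite q0 orbT.
have pq' : (p != 0) || (- q != 0) by rewrite oppr_eq0 q0 orbT.
(* For [q' != 0] the segment leaves the line of [e] right after its start at [e], hence misses 0.
   This is the origin of the condition [q != 0]. *)
have seg (q' : R) : q' != 0 -> forall t : R, 0 <= t <= 1 ->
    e + t *: (p *: e + q' *: v - e) != 0.
  move=> q'0 t _.
  have -> : e + t *: (p *: e + q' *: v - e) = (1 + t * (p - 1)) *: e + (t * q') *: v.
    rewrite [in LHS]addrAC scalerDr scalerA -[X in _ *: (_ - X)]scale1r -scalerBl scalerA.
    by rewrite addrA -{1}[e]scale1r -scalerDl.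
  apply: plane_neq0; have [t0|t0] := eqVneq t 0; first by rewrite t0 mul0r addr0 oner_neq0.
  by rewrite mulf_neq0 ?orbT.
have q'0 : - q != 0 by rewrite oppr_eq0.
have Bpt (q' : R) w : B (p *: e + q' *: v) w = p *: B e w + q' *: B v w.
  by rewrite /B christoffelDl !christoffelZl.
have ry := reflection_plane p q.
have y0 := plane_neq0 pq; have Wpq := slit_plane pq; have Wpq' := slit_plane pq'.
(* Under [v -> -v] the derivatives along [e] are even in [q] and those along [v] are odd. Comparing
   the connection at [q] and at [-q] removes the components of the wrong parity. *)
have Ra : dy e L (pt p (- q)) = dy e L (pt p q).
  by rewrite -(dy_energy_reflection openO finslerF Fphi Ore e v1 ev y0) ry reflection_id.
have Rb : dy v L (pt p (- q)) = - dy v L (pt p q).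
  rewrite -(dy_energy_reflection openO finslerF Fphi Ore v v1 ev y0) ry reflection_self//.
  by rewrite (dy_dirN _ sL Wpq') opprK.
have RX : dx e L (pt p (- q)) = dx e L (pt p q).
  by rewrite -(dx_energy_reflection openO finslerF Fphi Ore e v1 ev y0) ry reflection_id.
have RV : dx v L (pt p (- q)) = - dx v L (pt p q).
  rewrite -(dx_energy_reflection openO finslerF Fphi Ore v v1 ev y0) ry reflection_self//.
  by rewrite (dx_dirN _ sL Wpq') opprK.
have K := dx_energy_plane_v pq.
have V1 := HGam _ v y0 (seg q q0); have V2 := HGam _ v (plane_neq0 pq') (seg _ q'0).
have X1 := HGam _ e y0 (seg q q0); have X2 := HGam _ e (plane_neq0 pq') (seg _ q'0).
rewrite (dy_energy_plane _ pq) -/B Bpt !dotE in V1; rewrite (dy_energy_plane _ pq') -/B Bpt !dotE in V2.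
rewrite (dy_energy_plane _ pq) -/B Bpt !dotE Bve in X1; rewrite (dy_energy_plane _ pq') -/B Bpt !dotE Bve in X2.
rewrite Ra Rb RV in V2; rewrite Ra Rb RX in X2.
move: K V1 V2 X1 X2.
move: (dx v L _) (dx e L _) (dy e L _) (dy v L _) => DV DX a b.
move: (dot (B e v) e) (dot (B v v) e) (dot (B e v) v) (dot (B v v) v) (dot (B e e) e)
  (dot (B e e) v) => B1 B2 B3 B4 C1 C3.
move=> K V1 V2 X1 X2.
have KV : DV = q * B2 * a + p * B3 * b by lra.
have KX : DX = p * C1 * a + q * B3 * b by lra.
split; last by rewrite KX; ring.
(* The left-hand side is the derivative along [v] computed from rotations; matching it with the
   connection produces [kappa] and [lambda]. *)
have : (q * a - p * b) / r = q * B2 * a + p * B3 * b by rewrite -KV -K; field.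
by rewrite mulrBl => KK; lra.
Qed.

Lemma energy_plane_gt0 (p q : R) : (p != 0) || (q != 0) -> 0 < L (pt p q).
Proof.
move=> pq; have [pos _ _ _] := finslerF.
by rewrite exprn_gt0//; apply: pos => //; exact: plane_neq0.
Qed.

Lemma energy_planeN (p q : R) : (p != 0) || (q != 0) -> L (pt p (- q)) = L (pt p q).
Proof.
move=> pq; have pq' : (p != 0) || (- q != 0) by rewrite oppr_eq0.
apply: (energy_invariant Fphi) => //; rewrite ?plane_dot ?sqrrN//; try exact: plane_neq0.
by rewrite !dotE ev; ring.
Qed.

(** Degree 2 and evenness in [q] reduce [L] off the line [q = 0] to a function of the slope. *)
Lemma energy_plane_slope (p q : R) : q != 0 -> L (pt p q) = q ^+ 2 * L (pt (p / `|q|) 1).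
Proof.
have pos (p' q' : R) : 0 < q' -> L (pt p' q') = q' ^+ 2 * L (pt (p' / q') 1).
  move=> q0; rewrite -(homogeneous_energy finslerF)//; last first.
    by apply: plane_neq0; rewrite oner_neq0 orbT.
  by rewrite scalerDr !scalerA mulr1 mulrC divfK ?gt_eqF.
move=> qn0; case: (ltrP 0 q) => [q0|q_le]; first by rewrite gtr0_norm//; exact: pos.
have q1 : 0 < - q by rewrite oppr_gt0 lt_neqAle qn0.
rewrite ler0_norm//.
rewrite -(@energy_planeN p q) ?qn0 ?orbT// (pos p (- q) q1).
by rewrite sqrrN.
Qed.

Lemma continuous_plane (G : V * V -> R) (p : R) : smooth_on W G -> p != 0 ->
  {for (0 : R), continuous (fun s : R => G (pt p s))}.
Proof.
move=> sG p0; apply: (continuous_vertical sG Ore).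
by rewrite scale0r addr0 scaler_eq0 negb_or p0 unit_neq0.
Qed.

Lemma is_derive_plane_e (G : V * V -> R) (p q : R) : smooth_on W G -> (p != 0) || (q != 0) ->
  is_derive p (1 : R) (fun s : R => G (pt s q)) (dy e G (pt p q)).
Proof.
move=> sG pq.
have -> : (fun s : R => G (pt s q)) = (fun s => G (r *: e, q *: v + s *: e)).
  by apply/funext => s; rewrite addrC.
have y0 : q *: v + p *: e != 0 by rewrite addrC; exact: plane_neq0.
by rewrite [p *: e + _]addrC; exact: (is_derive_vertical sG Ore y0).
Qed.

(** If [kappa = lambda = 0], the radial equation of [berwald_plane] is the second alternative.
    Otherwise let [m p := L (pt p 1)] and let [b] be the derivative along [v] there:
    [kappa m' = lambda p b], and [p m' + b = 2 m] by Euler. Eliminating [b] gives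
    [(kappa + lambda p^2) m' = 2 lambda p m], so [m / (kappa + lambda p^2)] is constant. *)
Lemma berwald_dichotomy :
  (exists al be : R, forall p q : R, (p != 0) || (q != 0) ->
     L (pt p q) = al * p ^+ 2 + be * q ^+ 2) \/
  (exists mu : R, forall p q : R, (p != 0) || (q != 0) ->
     dx e L (pt p q) = mu * (p * dy e L (pt p q)) - r^-1 * (q * dy v L (pt p q))).
Proof.
have [ka [la [mu H]]] := berwald_plane.
have sdx w : smooth_on W (dx w L) by exact: smooth_dx.
have sdy w : smooth_on W (dy w L) by exact: smooth_dy.
have [/andP[/eqP ka0 /eqP la0]|kala] := boolP ((ka == 0) && (la == 0)).
  right; exists mu => p q pq.
  have [q0|q0] := eqVneq q 0; last by have [_ ->] := H p q q0; rewrite la0 sub0r mulNr.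
  rewrite q0 eqxx orbF in pq *.
  pose f (s : R) : R := dx e L (pt p s) - (mu * (p * dy e L (pt p s)) - r^-1 * (s * dy v L (pt p s))).
  suff : f 0 = 0 by move/eqP; rewrite subr_eq0 => /eqP.
  apply: continuous_eq0 => [|s s0]; last first.
    by rewrite /f; have [_ ->] := H p s s0; rewrite la0 sub0r mulNr subrr.
  have cX := continuous_plane (sdx e) pq; have ca := continuous_plane (sdy e) pq.
  have cb := continuous_plane (sdy v) pq.
  have cc (a : R) : {for (0 : R), continuous (cst a : R -> R)} by exact: cst_continuous.
  have ci : {for (0 : R), continuous (id : R -> R)} by exact: cvg_id.
  exact: (continuousB cX (continuousB (continuousM (cc mu) (continuousM (cc p) ca))
    (continuousM (cc r^-1) (continuousM ci cb)))).
left.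
have pt1 (p : R) : (p != 0) || ((1 : R) != 0) by rewrite oner_neq0 orbT.
have Hm (p : R) : (ka + la * p ^+ 2) * dy e L (pt p 1) = 2 * la * p * L (pt p 1).
  have [E _] := H p 1 (oner_neq0 _); have Eu := euler_plane (pt1 p).
  rewrite !mul1r in E Eu.
  have -> : 2 * la * p * L (pt p 1) = la * p * (2 * L (pt p 1)) by ring.
  rewrite -Eu; rewrite mulrDr [la * p * dy v L _](_ : _ = dy e L (pt p 1) * ka); first by ring.
  by rewrite E; ring.
(* As [m > 0], a zero of this coefficient forces [kappa = 0] and so [lambda != 0]. Then [b] vanishes
   for all [p != 0], and by continuity at [p = 0], where Euler's identity reads [b = 2 m]. *)
have D_ne (p : R) : ka + la * p ^+ 2 != 0.
  apply/eqP => D0; have := Hm p; rewrite D0 mul0r => /esym/eqP.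
  rewrite mulf_eq0 (gt_eqF (energy_plane_gt0 (pt1 p))) orbF -mulrA mulf_eq0 pnatr_eq0/=.
  move=> lap; have ka0 : ka = 0.
    by move: lap D0; rewrite mulf_eq0 => /orP[]/eqP ->; rewrite ?mul0r ?expr0n/= ?mulr0 addr0.
  have la0 : la != 0 by move: kala; rewrite ka0 eqxx.
  have b0 : dy v L (pt 0 1) = 0.
    apply: (@continuous_eq0 _ (fun s => dy v L (pt s 1))) => [|s s0].
      apply: differentiable_continuous; apply/derivable1_diffP.
      by have [] := is_derive_plane_e (sdy v) (pt1 0).
    have [E _] := H s 1 (oner_neq0 _); move/esym/eqP: E.
    by rewrite ka0 mulr0 !mulf_eq0 (negbTE s0) (negbTE la0) orbF => /eqP.
  have := euler_plane (pt1 0); rewrite b0 mulr0 mul0r addr0 => /esym/eqP.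
  by rewrite mulf_eq0 pnatr_eq0 (gt_eqF (energy_plane_gt0 (pt1 0))).
pose C := L (pt 0 1) / ka.
have mE (p : R) : L (pt p 1) = C * (ka + la * p ^+ 2).
  pose D (s : R) : R := ka + la * s ^+ 2.
  pose f (s : R) : R := L (pt s 1) * (D s)^-1.
  have df s : is_derive s (1 : R) f 0.
    have dD : is_derive s (1 : R) D (la * (2 * s)).
      have H2 : is_derive s (1 : R) (cst ka + la \*: (id ^+ 2)) (0 + la *: ((2 * s ^+ 1) *: 1)).
        by apply: is_deriveD.
      apply: (is_derive_eq (is_derive_eq H2 _)); last by [].
      by rewrite /GRing.scale/= expr1 mulr1 add0r.
    have Hf := is_deriveM (is_derive_plane_e sL (pt1 s)) (@is_deriveV R D s _ 1 (D_ne s) dD).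
    apply: (is_derive_eq Hf); rewrite /GRing.scale/=.
    have := Hm s; rewrite -/(D s) => E.
    have Dn : D s != 0 := D_ne s.
    apply: (@mulfI _ (D s ^+ 2)); first by rewrite expf_neq0.
    rewrite mulr0; transitivity (D s * dy e L (pt s 1) - 2 * la * s * L (pt s 1)); first by field.
    by rewrite E subrr.
  have Ef := is_derive_0_is_cst p 0 df.
  have : f p * D p = f 0 * D p by rewrite Ef.
  rewrite /f divfK ?D_ne// => ->; rewrite /C /D expr0n/= mulr0 addr0.
  by [].
have LE (p q : R) : q != 0 -> L (pt p q) = C * la * p ^+ 2 + C * ka * q ^+ 2.
  move=> q0; rewrite energy_plane_slope// mE.
  by rewrite expr_div_n real_normK ?num_real//; field.
exists (C * la), (C * ka) => p q pq.
have [q0|q0] := eqVneq q 0; last exact: LE.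
rewrite q0 eqxx orbF in pq *.
pose f (s : R) : R := L (pt p s) - (C * la * p ^+ 2 + C * ka * s ^+ 2).
suff : f 0 = 0 by move/eqP; rewrite subr_eq0 => /eqP.
apply: continuous_eq0 => [|s s0]; last by rewrite /f LE// subrr.
have cc (a : R) : {for (0 : R), continuous (cst a : R -> R)} by exact: cst_continuous.
have c2 : {for (0 : R), continuous ((fun s => s ^+ 2) : R -> R)} by exact: exprn_continuous.
exact: (continuousB (continuous_plane sL pq) (continuousD (cc _) (continuousM (cc _) c2))).
Qed.

End AtPoint.
End BerwaldPlane.

(** * The cylinder model *)

Section RealLine.
Context {R : realType}.

Lemma derive0_constant (f : R -> R) (a b x y : R) :
  (forall t, a < t < b -> is_derive t (1 : R) f 0) -> a < x < b -> a < y < b -> f x = f y.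
Proof.
move=> df; wlog xy : x y / x <= y.
  move=> H xI yI; case: (leP x y) => [|/ltW] xy; first exact: H.
  by apply/esym; exact: H.
move=> /andP[ax xb] /andP[ay yb].
have D t : t \in `[x, y]%R -> is_derive t (1 : R) f ((fun=> 0) t).
  by rewrite in_itv/= => /andP[xt ty]; apply: df; rewrite (lt_le_trans ax)//= (le_lt_trans ty).
have C : {within `[x, y], continuous f}.
  by apply: derivable_within_continuous => t /D [].
have [c _ E] := MVT_segment xy (fun t tI => D t (subset_itv_oo_cc tI)) C.
by move: E; rewrite mul0r => /eqP; rewrite subr_eq0 => /eqP.
Qed.

Lemma is_derive_continuous (f : R -> R) (t d : R) :
  is_derive t (1 : R) f d -> {for t, continuous f}.
Proof. by move=> [df _]; apply: differentiable_continuous; exact/derivable1_diffP. Qed.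

Lemma near_neq (f : R -> R) (t a : R) : {for t, continuous f} -> f t != a ->
  \forall s \near t, f s != a.
Proof.
move=> cf fa; have d0 : 0 < `|f t - a| by rewrite normr_gt0 subr_eq0.
have : \forall s \near t, `|f t - f s| < `|f t - a| by move/cvgrPdist_lt : cf => /(_ _ d0).
by apply: filterS => s; apply: contraTneq => ->; rewrite ltxx.
Qed.

End RealLine.

(** * The energy as a function of the radius and of radial and tangential components *)

Section Model.
Context {R : realType} {n : nat}.
Local Notation V := 'rV[R]_n.
Variables (Omega : set V) (F : V -> V -> R) (phi : R -> R -> R).
Hypothesis n_ge2 : (2 <= n)%N.
Hypothesis domO : domain Omega.
Hypothesis finslerF : finsler_metric Omega F.
Hypothesis Fphi : radial_form Omega F phi.
Local Notation W := (slit Omega).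
Local Notation L := (energy F).
Local Notation J := (radii Omega).
Implicit Types (x y u v w e : V).

Let openO : open Omega. Proof. by have [] := domO. Qed.
Let oW : open W. Proof. exact: open_slit. Qed.
Let sL : smooth_on W L. Proof. exact: smooth_energy. Qed.

(* [model r p q] is F^2 at radius r on a vector with radial part p and tangential part of length |q|. *)
Definition model (r p q : R) : R :=
  (p ^+ 2 + q ^+ 2) * phi r (r * p / Num.sqrt (p ^+ 2 + q ^+ 2)) ^+ 2.

Lemma energy_model (r p q : R) x y : Omega x -> y != 0 -> 0 < r -> dot x x = r ^+ 2 ->
  dot x y = r * p -> dot y y = p ^+ 2 + q ^+ 2 -> L (x, y) = model r p q.
Proof.
move=> Ox y0 r0 xx xy yy; rewrite /energy/=.
have [_ ->] := Fphi Ox y0.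
have -> : enorm x = r by rewrite /enorm xx sqrtr_sqr gtr0_norm.
by rewrite /svar xy exprMn enorm_sqr /enorm yy.
Qed.

Lemma energy_plane_model (r p q : R) e v : dot e e = 1 -> dot v v = 1 -> dot e v = 0 ->
  0 < r -> Omega (r *: e) -> (p != 0) || (q != 0) ->
  L (r *: e, p *: e + q *: v) = model r p q.
Proof.
move=> e1 v1 ev r0 Ore pq; apply: energy_model => //.
- exact: plane_neq0.
- by rewrite !dotE e1; ring.
- by rewrite !dotE e1 ev; ring.
- exact: plane_dot.
Qed.

Lemma radiiP (r : R) : J r -> 0 < r /\ exists e v,
  [/\ dot e e = 1, dot v v = 1, dot e v = 0 & Omega (r *: e)].
Proof.
move=> [x [Ox x0 ->]]; have [r1 [e [r0 e1 xE ->]]] := polar_decomposition x0.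
split=> //; have [v v1 ev] := exists_orthonormal e n_ge2.
by exists e, v; split=> //; rewrite -xE.
Qed.

Lemma mem_radii (r : R) e : 0 < r -> dot e e = 1 -> Omega (r *: e) -> J r.
Proof.
move=> r0 e1 Ore; exists (r *: e); split=> //.
  by rewrite scaler_eq0 negb_or gt_eqF// unit_neq0.
by rewrite enormZ ?ltW// enorm_unit// mulr1.
Qed.

Lemma near_ray (r : R) e : Omega (r *: e) -> \forall t \near r, Omega (t *: e).
Proof.
move=> Ore.
have cr : {for r, continuous (fun t : R => t *: e)} by exact: scalel_continuous.
by apply: cr; exact: open_nbhs_nbhs.
Qed.

Lemma open_radii : open J.
Proof.
rewrite openE => r /radiiP[r0 [e [v [e1 _ _ Ore]]]]; rewrite /interior.
near=> t; apply: (@mem_radii t e) => //; near: t; [exact: lt_nbhsr|exact: near_ray].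
Unshelve. all: by end_near. Qed.

Lemma continuous_enorm : continuous (@enorm R n).
Proof.
move=> x; apply: (@continuous_comp _ _ _ (fun x => dot x x) Num.sqrt); last first.
  exact: sqrt_continuous.
have -> : (fun x : V => dot x x) = \sum_(i < n) (fun x : V => x ord0 i * x ord0 i).
  by apply/funext => z; rewrite fct_sumE.
apply: differentiable_continuous; apply: differentiable_sum => i.
by apply: (@differentiableM _ _ (fun x : V => x ord0 i) (fun x : V => x ord0 i));
  exact: differentiable_coord.
Qed.

(** The norms of the points of [Omega] form an interval of nonnegative numbers, and it remains an
    interval when 0 is dropped. *)
Lemma connected_radii : connected J.
Proof.
have [_ _ cO] := domO.
have : connected (@enorm R n @` Omega).
  by apply: connected_continuous_connected => //; apply: continuous_subspaceT; exact: continuous_enorm.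
move=> /connected_intervalP iO; apply/connected_intervalP => a b [x [Ox x0 ->]] [y [Oy y0 ->]] c cI.
have [z Oz Ez] : (@enorm R n @` Omega) c by apply: (iO (enorm x) (enorm y)) => //.
exists z; split=> //; apply/eqP => z0; move: cI; rewrite -Ez z0 => /andP[+ _].
have -> : enorm (0 : V) = 0 by rewrite /enorm dot0l sqrtr0.
by rewrite leNgt enorm_gt0.
Qed.

Definition radial_energy (r : R) : R := model r 1 0.

(** [P = sqrt lam * p] is the radial speed measured by [F]-length along the outgoing ray, and
    [Q = q / r] is the angular speed: the components in the product of a line with the unit
    sphere. *)
Definition cylinder_model (r P Q : R) : R := model r (P / Num.sqrt (radial_energy r)) (Q * r).

Definition quadratic_at (r : R) := exists al be : R, forall p q : R, (p != 0) || (q != 0) ->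
  model r p q = al * p ^+ 2 + be * q ^+ 2.

Lemma model_gt0 (r p q : R) : J r -> (p != 0) || (q != 0) -> 0 < model r p q.
Proof.
move=> /radiiP[r0 [e [v [e1 v1 ev Ore]]]] pq.
by rewrite -(energy_plane_model e1 v1 ev)//; exact: (energy_plane_gt0 finslerF e1 v1 ev).
Qed.

Lemma radial_energy_gt0 r : J r -> 0 < radial_energy r.
Proof. by move=> Jr; apply: model_gt0 => //; rewrite oner_neq0. Qed.

Section AtPoint.
Variables (r : R) (e v : V).
Hypotheses (r0 : 0 < r) (e1 : dot e e = 1) (v1 : dot v v = 1) (ev : dot e v = 0)
  (Ore : Omega (r *: e)).

Local Notation pt p q := (r *: e, p *: e + q *: v).
Let Jr : J r. Proof. exact: mem_radii Ore. Qed.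

Lemma is_derive_radial_curve (a b : R -> R) (da db : R) :
  is_derive r (1 : R) a da -> is_derive r (1 : R) b db -> (a r != 0) || (b r != 0) ->
  is_derive r (1 : R) (fun t => L (t *: e, a t *: e + b t *: v))
    (dx e L (pt (a r) (b r)) + da * dy e L (pt (a r) (b r)) + db * dy v L (pt (a r) (b r))).
Proof.
move=> dera derb ab; have Wab := slit_plane e1 v1 ev Ore ab.
pose c (t : R) : V * V := (t *: e, a t *: e + b t *: v).
have dc : is_derive r (1 : R) c (1 *: e, da *: e + db *: v).
  apply: is_derive_pair; first exact: is_derive_scalev.
  by apply: is_deriveD; exact: is_derive_scalev.
have dL : differentiable (L : V * V -> R^o) (c r) by exact: smooth_on_differentiable Wab.
have := is_derive_curve dc dL.
have -> : ((1 *: e, da *: e + db *: v) : V * V) = (e, 0) + (0, da *: e + db *: v).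
  by congr pair; rewrite /= ?addr0 ?scale1r// add0r.
rewrite (derive_dirD dL) => H; apply: (is_derive_eq H).
rewrite -addrA -!(dy_dirZ _ _ sL Wab) -(dy_dirD _ _ sL Wab).
by rewrite dx.unlock dy.unlock.
Qed.

Lemma model_near (a b : R -> R) : {for r, continuous a} -> {for r, continuous b} ->
  (a r != 0) || (b r != 0) ->
  \forall t \near r, L (t *: e, a t *: e + b t *: v) = model t (a t) (b t).
Proof.
move=> ca cb ab.
have nab : \forall t \near r, (a t != 0) || (b t != 0).
  case/orP: ab => H.
    by have := near_neq ca H; apply: filterS => t ->.
  by have := near_neq cb H; apply: filterS => t ->; rewrite orbT.
near=> t; apply: energy_plane_model => //; near: t.
- exact: lt_nbhsr.
- exact: near_ray.
- exact: nab.
Unshelve. all: by end_near. Qed.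

(** [phi] carries no regularity, so the derivative is taken on [L], with which the model agrees near
    [r]. *)
Lemma is_derive_model (a b : R -> R) (da db : R) :
  is_derive r (1 : R) a da -> is_derive r (1 : R) b db -> (a r != 0) || (b r != 0) ->
  is_derive r (1 : R) (fun t => model t (a t) (b t))
    (dx e L (pt (a r) (b r)) + da * dy e L (pt (a r) (b r)) + db * dy v L (pt (a r) (b r))).
Proof.
move=> dera derb ab.
apply: near_eq_is_derive (is_derive_radial_curve dera derb ab).
by apply: model_near => //; exact: is_derive_continuous.
Qed.

Lemma is_derive_radial_energy : is_derive r (1 : R) radial_energy (dx e L (pt 1 0)).
Proof.
have H := is_derive_model (is_derive_cst (1 : R) r (1 : R)) (is_derive_cst (0 : R) r (1 : R)).
have := H (introT orP (or_introl (oner_neq0 R))).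
by rewrite !mul0r !addr0.
Qed.

Lemma is_derive_cylinder_model P Q : (P != 0) || (Q != 0) ->
  let p := P / Num.sqrt (radial_energy r) in let q := Q * r in
  is_derive r (1 : R) (fun t => cylinder_model t P Q)
    (dx e L (pt p q) - p * (dx e L (pt 1 0) / (2 * radial_energy r)) * dy e L (pt p q)
     + Q * dy v L (pt p q)).
Proof.
move=> PQ p q; have l0 := radial_energy_gt0 Jr.
have s0 : 0 < Num.sqrt (radial_energy r) by rewrite sqrtr_gt0.
have pq : (p != 0) || (q != 0).
  rewrite !mulf_eq0 !negb_or invr_eq0 (gt_eqF s0) (gt_eqF r0) !andbT.
  exact: PQ.
have dp : is_derive r (1 : R) (fun t => P / Num.sqrt (radial_energy t))
    (- (p * (dx e L (pt 1 0) / (2 * radial_energy r)))).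
  have ds : is_derive r (1 : R) (Num.sqrt \o radial_energy)
      ((2 * Num.sqrt (radial_energy r))^-1 * dx e L (pt 1 0)).
    by apply: is_derive1_comp; [exact: is_derive1_sqrt|exact: is_derive_radial_energy].
  have Hv := @is_deriveV R (Num.sqrt \o radial_energy) r _ 1 (lt0r_neq0 s0) ds.
  apply: (is_derive_eq (is_deriveZ P Hv)); rewrite /p /GRing.scale/=.
  have E : radial_energy r = Num.sqrt (radial_energy r) ^+ 2 by rewrite sqr_sqrtr// ltW.
  rewrite [in RHS]E sqrtr_sqr ger0_norm ?ltW//; field.
  by rewrite gt_eqF.
have dq : is_derive r (1 : R) (fun t => Q * t) Q.
  have Hi := is_deriveZ Q (is_derive_id r (1 : R)).
  by apply: (is_derive_eq Hi); rewrite /GRing.scale/= mulr1.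
apply: (is_derive_eq (is_derive_model dp dq pq)).
by rewrite mulNr.
Qed.

Lemma berwald_model : berwald_metric Omega F -> quadratic_at r \/
  forall P Q, (P != 0) || (Q != 0) -> is_derive r (1 : R) (fun t => cylinder_model t P Q) 0.
Proof.
move=> bF.
have [[al [be H]]|[mu H]] := berwald_dichotomy openO finslerF Fphi bF r0 e1 v1 ev Ore.
  by left; exists al, be => p q pq; rewrite -(energy_plane_model e1 v1 ev)//; exact: H.
right=> P Q PQ; have l0 := radial_energy_gt0 Jr.
have s0 : 0 < Num.sqrt (radial_energy r) by rewrite sqrtr_gt0.
apply: (is_derive_eq (is_derive_cylinder_model PQ)).
have pq1 : ((1 : R) != 0) || ((0 : R) != 0) by rewrite oner_neq0.
(* At [(1, 0)] Euler's identity says that the derivative along [e] is [2 lam], so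
   [mu = lam' / (2 lam)]. This is the rate that the division by [sqrt lam] in [cylinder_model]
   compensates. *)
have E1 := H 1 0 pq1; have Eu := euler_plane openO finslerF Fphi e1 v1 ev Ore pq1.
rewrite !mul0r !mul1r addr0 in Eu; rewrite !mul0r !mul1r mulr0 subr0 Eu in E1.
rewrite (energy_plane_model e1 v1 ev r0 Ore pq1) -/(radial_energy r) in E1.
have pq : (P / Num.sqrt (radial_energy r) != 0) || (Q * r != 0).
  rewrite !mulf_eq0 !negb_or invr_eq0 (gt_eqF r0) (gt_eqF s0).
  by rewrite !andbT.
rewrite (H _ _ pq) E1; field.
by rewrite !lt0r_neq0.
Qed.

End AtPoint.


(** In cylinder components, being quadratic is a set of equations between values at fixed [(P, Q)].
    So it depends on the cylinder model alone, and its failure is an open condition on [r]. *)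
Lemma quadratic_atP r : J r -> quadratic_at r <->
  forall P Q, (P != 0) || (Q != 0) -> cylinder_model r P Q =
    P ^+ 2 * cylinder_model r 1 0 + Q ^+ 2 * cylinder_model r 0 1.
Proof.
move=> Jr; have [r0 _] := radiiP Jr; have l0 := radial_energy_gt0 Jr.
have s0 : 0 < Num.sqrt (radial_energy r) by rewrite sqrtr_gt0.
have [sn rn] := (lt0r_neq0 s0, lt0r_neq0 r0).
have nz P Q : (P != 0) || (Q != 0) -> (P / Num.sqrt (radial_energy r) != 0) || (Q * r != 0).
  by rewrite !mulf_eq0 !negb_or invr_eq0 rn sn !andbT.
split=> [[al [be H]] P Q PQ|H].
  rewrite /cylinder_model !H ?nz ?oner_neq0 ?orbT//; field.
  by [].
exists (Num.sqrt (radial_energy r) ^+ 2 * cylinder_model r 1 0), (r ^- 2 * cylinder_model r 0 1) => p q pq.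
have E : model r p q = cylinder_model r (p * Num.sqrt (radial_energy r)) (q / r).
  by rewrite /cylinder_model mulfK// divfK.
rewrite E H; last by rewrite !mulf_eq0 !negb_or invr_eq0 rn sn !andbT.
by field.
Qed.

Lemma continuous_cylinder_model r P Q : J r -> (P != 0) || (Q != 0) ->
  {for r, continuous (fun t => cylinder_model t P Q)}.
Proof.
move=> /radiiP[r0 [e [v [e1 v1 ev Ore]]]] PQ.
exact: is_derive_continuous (is_derive_cylinder_model r0 e1 v1 ev Ore PQ).
Qed.

Lemma near_not_quadratic r : J r -> ~ quadratic_at r -> \forall t \near r, ~ quadratic_at t.
Proof.
move=> Jr; rewrite (quadratic_atP Jr) => /existsNP[P /existsNP[Q /not_implyP[PQ /eqP NE]]].
pose f (t : R) : R := cylinder_model t P Q -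
  (P ^+ 2 * cylinder_model t 1 0 + Q ^+ 2 * cylinder_model t 0 1).
have pq10 : ((1 : R) != 0) || ((0 : R) != 0) by rewrite oner_neq0.
have pq01 : ((0 : R) != 0) || ((1 : R) != 0) by rewrite oner_neq0 orbT.
have cc (a : R) : {for r, continuous (cst a : R -> R)} by exact: cst_continuous.
have cf : {for r, continuous f}.
  exact: (continuousB (continuous_cylinder_model Jr PQ) (continuousD
   (continuousM (cc _) (continuous_cylinder_model Jr pq10))
   (continuousM (cc _) (continuous_cylinder_model Jr pq01)))).
have f0 : f r != 0 by rewrite subr_eq0.
have Jnear : \forall t \near r, J t by apply: open_nbhs_nbhs; split=> //; exact: open_radii.
near=> t; have Jt : J t by near: t.
rewrite (quadratic_atP Jt) => /(_ P Q PQ) /eqP; rewrite -subr_eq0; apply/negP.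
by near: t; exact: near_neq cf f0.
Unshelve. all: by end_near. Qed.

(* The two alternatives cannot be mixed: the set of radii whose cylinder model coincides with a given
   non-quadratic one is open and closed in the interval of radii. *)
Lemma berwald_global : berwald_metric Omega F ->
  (forall r, J r -> quadratic_at r) \/
  (exists2 r0, J r0 & forall r P Q, J r -> (P != 0) || (Q != 0) ->
    cylinder_model r P Q = cylinder_model r0 P Q).
Proof.
move=> bF; have [|/existsNP[r0 /not_implyP[Jr0 nq0]]] := pselect (forall r, J r -> quadratic_at r).
  by left.
right; exists r0 => //.
pose Z := [set r | J r /\ forall P Q, (P != 0) || (Q != 0) ->
  cylinder_model r P Q = cylinder_model r0 P Q].
suff ZJ : Z = J by move=> r P Q Jr PQ; move: Jr; rewrite -ZJ => -[_]; exact.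
have Jnear r : J r -> \forall t \near r, J t.
  by move=> Jr; apply: open_nbhs_nbhs; split=> //; exact: open_radii.
have pq10 : ((1 : R) != 0) || ((0 : R) != 0) by rewrite oner_neq0.
have pq01 : ((0 : R) != 0) || ((1 : R) != 0) by rewrite oner_neq0 orbT.
have openZ : open Z.
  rewrite openE => r [Jr ZE]; rewrite /interior.
  (* A radius in [Z] has the cylinder model of [r0], hence is not quadratic. Neither are the nearby
     radii, so there the second alternative holds and the model is locally constant. *)
  have nq : ~ quadratic_at r.
    move=> /(quadratic_atP Jr) H; apply: nq0; apply/(quadratic_atP Jr0) => P Q PQ.
    by rewrite -!ZE//; exact: H.
  have N : \forall t \near r, J t /\ ~ quadratic_at t.
    by apply: filterI; [exact: Jnear|exact: near_not_quadratic].
  have [d /= d0 Hd] := (nbhs_ballP _ _).1 N.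
  apply/nbhs_ballP; exists d => //= t rt.
  have inb (s : R) : r - d < s < r + d -> ball r d s.
    by move=> sI; rewrite /ball/= ltr_distlC.
  have tI : r - d < t < r + d by move: rt; rewrite /ball/= ltr_distlC.
  have [Jt _] := Hd t rt; split=> // P Q PQ; rewrite -ZE//.
  apply: (@derive0_constant _ (fun t => cylinder_model t P Q) (r - d) (r + d)) => //; last first.
    by rewrite ltrDl d0 andbT gtrBl.
  move=> s /inb /Hd[Js nqs]; have [s0 [e [v [e1 v1 ev Ose]]]] := radiiP Js.
  by have [//|] := berwald_model s0 e1 v1 ev Ose bF; exact.
have openC : open (J `\` Z).
  rewrite openE => r [Jr nZ]; rewrite /interior.
  have /existsNP[P /existsNP[Q /not_implyP[PQ /eqP NE]]] : ~ forall P Q, (P != 0) || (Q != 0) ->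
      cylinder_model r P Q = cylinder_model r0 P Q by move=> H; apply: nZ.
  have c := continuous_cylinder_model Jr PQ.
  have Nn := near_neq c NE.
  near=> t; split; first by near: t; exact: Jnear.
  move=> [_ /(_ P Q PQ)]; apply/eqP; near: t; exact: Nn.
apply: connected_radii.
- by exists r0.
- by exists Z => //; apply/seteqP; split=> [r [Jr ZE]|r []].
- exists (~` (J `\` Z)); first exact: open_closedC.
  apply/seteqP; split=> [r Zr|r [Jr nZ]]; first by split; [case: Zr|move=> []].
  by apply: contrapT => nZr; apply: nZ.
Unshelve. all: by end_near. Qed.

End Model.

(** * Riemannian metrics *)

Section QuadraticForms.
Context {R : realType} {n : nat}.
Local Notation V := 'rV[R]_n.
Local Notation e := (basis_vec R).
Implicit Types (G H : V * V -> R) (x y v w : V) (p : V * V).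

(** A y-derivative sees only the fibre over [x], so an identity known at a single [x] may be
    differentiated in y. *)
Lemma dy_slice w G H x y : y != 0 -> (forall y', y' != 0 -> G (x, y') = H (x, y')) ->
  dy w G (x, y) = dy w H (x, y).
Proof.
move=> y0 GH; rewrite dy.unlock -!derive_snd; apply: near_eq_derive.
exact: near_in_open open_neq0 _ _ y0 GH.
Qed.

Definition snd_linear (d : 'I_n -> R) : V * V -> R := fun p => \sum_(b < n) p.2 ord0 b * d b.

Definition snd_quadratic (c : 'I_n -> 'I_n -> R) : V * V -> R :=
  fun p => \sum_(a < n) p.2 ord0 a * snd_linear (c a) p.

Lemma dy_cst w (a : R) p : dy w (fun=> a) p = 0.
Proof. by rewrite dy.unlock derive_cst. Qed.

Lemma smooth_snd_linear d : smooth_on setT (snd_linear d).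
Proof.
apply: (@smooth_on_sum_mul _ _ _ openT (@snd_coord R n) (fun b _ => d b)) => b.
  by apply: smooth_snd_coord; exact: openT.
by apply: smooth_on_cst; exact: openT.
Qed.

Lemma dy_snd_linear i d p : dy (e i) (snd_linear d) p = d i.
Proof.
have := @dy_sum_mul R n setT (e i) (@snd_coord R n) (fun b _ => d b) p.
move=> /(_ (fun b => smooth_snd_coord b openT) (fun b => smooth_on_cst openT (d b)) I).
have -> : dy (e i) (snd_linear d) p =
    dy (e i) (fun q => \sum_(b < n) snd_coord b q * d b) p by [].
move=> ->; rewrite [X in _ + X]big1 ?addr0; last by move=> b _; rewrite dy_cst mulr0.
rewrite (bigD1 i)//= dy_snd_coord eqxx mul1r big1 ?addr0// => b bi.
by rewrite dy_snd_coord (negbTE bi) mul0r.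
Qed.

Lemma dy_snd_quadratic i c p :
  dy (e i) (snd_quadratic c) p = snd_linear (fun b => c i b + c b i) p.
Proof.
have := @dy_sum_mul R n setT (e i) (@snd_coord R n) (fun a => snd_linear (c a)) p.
move=> /(_ (fun b => smooth_snd_coord b openT) (fun b => smooth_snd_linear (c b)) I).
have -> : dy (e i) (snd_quadratic c) p =
    dy (e i) (fun q => \sum_(a < n) snd_coord a q * snd_linear (c a) q) p by [].
move=> ->; rewrite (bigD1 i)//= dy_snd_coord eqxx mul1r big1 ?addr0; last first.
  by move=> b bi; rewrite dy_snd_coord (negbTE bi) mul0r.
rewrite -big_split/=; apply: eq_bigr => b _.
by rewrite dy_snd_linear mulrDr.
Qed.

Lemma dy2_quadratic i j c G x y : y != 0 ->
  (forall y', y' != 0 -> G (x, y') = snd_quadratic c (x, y')) ->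
  dy (e i) (dy (e j) G) (x, y) = c j i + c i j.
Proof.
move=> y0 GQ; rewrite (@dy_slice _ _ (snd_linear (fun b => c j b + c b j)))//.
  exact: dy_snd_linear.
by move=> y' y'0; rewrite (dy_slice _ y'0 GQ) dy_snd_quadratic.
Qed.

Lemma dy3_quadratic i j k c G x y : y != 0 ->
  (forall y', y' != 0 -> G (x, y') = snd_quadratic c (x, y')) ->
  dy (e i) (dy (e j) (dy (e k) G)) (x, y) = 0.
Proof.
move=> y0 GQ; rewrite (@dy_slice _ _ (fun=> c k j + c j k))//; first exact: dy_cst.
by move=> y' y'0; exact: dy2_quadratic.
Qed.

End QuadraticForms.

Section RiemannianBerwald.
Context {R : realType} {n : nat}.
Local Notation V := 'rV[R]_n.
Variables (Omega : set V) (F : V -> V -> R).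
Hypothesis openO : open Omega.
Hypothesis finslerF : finsler_metric Omega F.
Local Notation W := (slit Omega).
Local Notation L := (energy F).
Local Notation e := (basis_vec R).
Implicit Types (x y : V) (p : V * V).

Let oW : open W. Proof. exact: open_slit. Qed.
Let sL : smooth_on W L. Proof. exact: smooth_energy. Qed.

Lemma riemannian_energy : riemannian Omega F <-> forall x y y' i j, Omega x -> y != 0 -> y' != 0 ->
  dy (e i) (dy (e j) L) (x, y) = dy (e i) (dy (e j) L) (x, y').
Proof.
split=> [rF x y y' i j Ox y0 y'0|H x y y' Ox y0 y'0].
  have E : fundamental_tensor F x y i j = fundamental_tensor F x y' i j.
    by rewrite (rF x y y').
  have n2 : (2^-1 : R) != 0 by rewrite invr_eq0 pnatr_eq0.
  apply: (mulfI n2).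
  exact: etrans (esym (fundamental_tensorE F x y i j)) (etrans E (fundamental_tensorE F x y' i j)).
apply/matrixP => i j.
apply: (etrans (fundamental_tensorE F x y i j)).
apply: (etrans _ (esym (fundamental_tensorE F x y' i j))).
by rewrite (H x y y').
Qed.

(** The index [i] has been lowered by the invertible matrix [g], up to a factor 2. *)
Lemma berwald_curvature_unique p (j k l : 'I_n) : W p ->
  (forall m, \sum_(i < n) dy (e j) (dy (e k) (dy (e l) (spray_coef F i))) p *
     dy (e m) (dy (e i) L) p = 0) ->
  forall i, dy (e j) (dy (e k) (dy (e l) (spray_coef F i))) p = 0.
Proof.
case: p => x y Wp H i; have uM := fundamental_tensor_unitmx finslerF Wp.
pose b : 'cV[R]_n := \col_i dy (e j) (dy (e k) (dy (e l) (spray_coef F i))) (x, y).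
have gb : fundamental_tensor F x y *m b = 0.
  apply/colP => m; rewrite [LHS]mxE [RHS]mxE; have H2 := congr1 (fun z : R => 2^-1 * z) (H m).
  rewrite mulr0 in H2; apply: (etrans _ H2); rewrite [RHS]mulr_sumr.
  apply: eq_bigr => a _; rewrite (fundamental_tensorE F x y m a) [b _ _]mxE; ring.
have b0 : b = 0 by rewrite -(mulKmx uM b) gb mulmx0.
by move/colP/(_ i): b0; rewrite !mxE.
Qed.

(** Third y-derivatives of [L] vanish, so three y-derivatives of the spray equation leave the
    Berwald curvature, with one index lowered, on one side. On the other side two of them remove the
    explicit factor [y^k], and the third meets only second y-derivatives of [L]. *)
Lemma riemannian_berwald : riemannian Omega F -> berwald_metric Omega F.
Proof.
move=> /riemannian_energy rF.
have ss i := smooth_spray openO finslerF i.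
have s2 a b : smooth_on W (dy (e a) (dy (e b) L)) by do 2 apply: smooth_dy.
have L3 a b c p : W p -> dy (e a) (dy (e b) (dy (e c) L)) p = 0.
  move=> [Op p0]; case: p Op p0 => x y /= Ox y0.
  rewrite (@dy_slice _ _ _ _ (fun=> dy (e b) (dy (e c) L) (x, y)))//; first exact: dy_cst.
  by move=> y' y'0; exact: rF.
have dxL3 k a b c p : W p -> dx (e k) (dy (e a) (dy (e b) (dy (e c) L))) p = 0.
  move=> Wp; rewrite (@eq_dx _ _ W oW (e k) _ (fun=> 0) p Wp); last by move=> q Wq; exact: L3.
  by rewrite dx.unlock derive_cst.
have L2x k a b c p : W p -> dy (e a) (dx (e k) (dy (e b) (dy (e c) L))) p = 0.
  by move=> Wp; rewrite -(dxyC oW (e k) (e a) (s2 b c) Wp) dxL3.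
(* Each y-derivative of the spray equation only acts on the spray coefficients. *)
have leibniz m a (H : 'I_n -> V * V -> R) p : (forall i, smooth_on W (H i)) -> W p ->
    dy (e a) (fun q => 2 * \sum_(i < n) H i q * dy (e m) (dy (e i) L) q) p =
    2 * \sum_(i < n) dy (e a) (H i) p * dy (e m) (dy (e i) L) p.
  move=> sH Wp.
  rewrite (@dyZ _ _ W (e a) 2 _ p (smooth_on_sum_mul oW sH (s2 m)) Wp).
  rewrite (@dy_sum_mul _ _ W (e a) H (fun i => dy (e m) (dy (e i) L)) p sH (s2 m) Wp).
  by rewrite [X in _ + X]big1 ?addr0// => i _; rewrite L3// mulr0.
have E1 m l p : W p ->
    2 * \sum_(i < n) dy (e l) (spray_coef F i) p * dy (e m) (dy (e i) L) p =
    dx (e l) (dy (e m) L) p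
    + \sum_(k < n) p.2 ord0 k * dx (e k) (dy (e l) (dy (e m) L)) p
    - dx (e m) (dy (e l) L) p.
  move=> Wp; rewrite -(dy_spray_rhs openO finslerF l m Wp) -leibniz//.
  apply: (eq_dy oW) => // q Wq; by rewrite (spray_eq finslerF m Wq).
have E2 m k l p : W p ->
    2 * \sum_(i < n) dy (e k) (dy (e l) (spray_coef F i)) p * dy (e m) (dy (e i) L) p =
    dx (e l) (dy (e k) (dy (e m) L)) p + dx (e k) (dy (e l) (dy (e m) L)) p
    - dx (e m) (dy (e k) (dy (e l) L)) p.
  move=> Wp; rewrite -leibniz//; last by move=> i; exact: smooth_dy.
  have sd a b : smooth_on W (dx (e a) (dy (e b) L)) by apply: smooth_dx; exact: smooth_dy.
  have sdd i : smooth_on W (dx (e i) (dy (e l) (dy (e m) L))) by apply: smooth_dx.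
  have sc i : smooth_on W (@snd_coord R n i) by exact: smooth_snd_coord.
  pose S q := \sum_(i < n) snd_coord i q * dx (e i) (dy (e l) (dy (e m) L)) q.
  have sS : smooth_on W S by exact: smooth_on_sum_mul.
  rewrite (@eq_dy _ _ W oW _ _ (fun q => (dx (e l) (dy (e m) L) q + S q)
    - dx (e m) (dy (e l) L) q) p Wp); last by move=> q Wq; rewrite E1.
  rewrite (@dyB _ _ W _ _ _ p _ (sd m l) Wp); last exact: smooth_onD.
  rewrite (@dyD _ _ W _ _ _ p (sd l m) sS Wp).
  rewrite (dxyC oW (e l) (e k) (smooth_dy (e m) sL) Wp) (dxyC oW (e m) (e k) (smooth_dy (e l) sL) Wp).
  rewrite (@dy_sum_mul _ _ W (e k) _ _ p sc sdd Wp) [X in _ + (_ + X)]big1; last first.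
    by move=> i _; rewrite L2x// mulr0.
  rewrite addr0 (bigD1 k)//= dy_snd_coord eqxx mul1r big1 ?addr0// => b bk.
  by rewrite dy_snd_coord (negbTE bk) mul0r.
move=> x y Ox y0 i j k l; have Wxy : W (x, y) by [].
rewrite berwald_curvatureE; apply: berwald_curvature_unique => // m.
have sdx2 a b c : smooth_on W (dx (e a) (dy (e b) (dy (e c) L))) by apply: smooth_dx.
have H2 : (2 : R) != 0 by rewrite pnatr_eq0.
apply: (mulfI H2); rewrite mulr0 -leibniz//; last by move=> a; do 2 apply: smooth_dy.
rewrite (@eq_dy _ _ W oW _ _ (fun q => (dx (e l) (dy (e k) (dy (e m) L)) q
  + dx (e k) (dy (e l) (dy (e m) L)) q) - dx (e m) (dy (e k) (dy (e l) L)) q) (x, y) Wxy);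
  last by move=> q Wq; rewrite E2.
rewrite (@dyB _ _ W _ _ _ (x, y) _ (sdx2 m k l) Wxy); last exact: smooth_onD.
by rewrite (@dyD _ _ W _ _ _ (x, y) (sdx2 l k m) (sdx2 k l m) Wxy) !L2x// addr0 subrr.
Qed.

End RiemannianBerwald.

(** * From Berwald metrics to the formula *)

Section AffineLine.
Context {R : realType} {V : normedModType R}.

Lemma smooth_on_line (U : set V) (f : V -> R^o) (a w : V) (T : set R^o) :
  open U -> open T -> (forall t, T t -> U (a + t *: w)) ->
  smooth_on U f -> smooth_on (V := R^o) T (fun t => f (a + t *: w)).
Proof.
move=> oU oT TU /smooth_onP sf; apply/smooth_onP => k.
elim: k f sf => [|k IH] f sf.
  split=> // t Tt; have df := Ck_differentiable (sf 0%N) (TU t Tt).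
  by apply/derivable1_diffP; have [] := is_derive_curve (is_derive_line a w t) df.
have dft t : T t -> differentiable ((fun t : R^o => f (a + t *: w)) : R^o -> R^o) t.
  move=> Tt; have df := Ck_differentiable (sf 0%N) (TU t Tt).
  by apply/derivable1_diffP; have [] := is_derive_curve (is_derive_line a w t) df.
split=> // s.
apply: (@Ck_eq _ _ _ oT _ (fun t => (cst (s : R) t : R) * ('D_w f (a + t *: w) : R))).
  move=> t Tt; have df := Ck_differentiable (sf 0%N) (TU t Tt).
  have -> : s = s *: (1 : R^o) by rewrite /GRing.scale/= mulr1.
  rewrite (derive_dirZ (dft t Tt)); apply: mulr_congr; first by rewrite /cst /GRing.scale/= mulr1.
  by have [_ ->] := is_derive_curve (is_derive_line a w t) df.
apply: (@Ck_mul _ _ _ oT _ (cst (s : R)) (fun t => 'D_w f (a + t *: w))); first exact: Ck_cst.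
exact: (IH ('D_w f) (fun j => (sf j.+1).2 w)).
Qed.

End AffineLine.

Section Forward.
Context {R : realType} {n : nat}.
Local Notation V := 'rV[R]_n.
Variables (Omega : set V) (F : V -> V -> R) (phi : R -> R -> R).
Hypothesis n_ge2 : (2 <= n)%N.
Hypothesis domO : domain Omega.
Hypothesis finslerF : finsler_metric Omega F.
Hypothesis Fphi : radial_form Omega F phi.
Local Notation W := (slit Omega).
Local Notation L := (energy F).
Local Notation J := (radii Omega).
Local Notation lam := (radial_energy phi).
Implicit Types (x y u v w e : V).

Let openO : open Omega. Proof. by have [] := domO. Qed.
Let oW : open W. Proof. exact: open_slit. Qed.
Let sL : smooth_on W L. Proof. exact: smooth_energy. Qed.

(** The difference is the squared length of the part of [y] orthogonal to [e]. *)
Lemma dot_unit_le e y : dot e e = 1 -> dot y e ^+ 2 <= dot y y.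
Proof.
move=> e1; rewrite -subr_ge0.
have -> : dot y y - dot y e ^+ 2 = dot (y - dot y e *: e) (y - dot y e *: e).
  by rewrite !dotE e1 (dotC e y); ring.
exact: dot_ge0.
Qed.

Lemma energy_radial x y : Omega x -> x != 0 -> y != 0 ->
  let r := enorm x in let p := dot x y / r in let q := Num.sqrt (dot y y - p ^+ 2) in
  L (x, y) = model phi r p q /\ p ^+ 2 + q ^+ 2 = dot y y.
Proof.
move=> Ox x0 y0 r p q; have [r1 [e [r0 e1 xE rE]]] := polar_decomposition x0.
have rr : r = r1 by rewrite /r rE.
have pE : p = dot y e by rewrite /p rr xE dotZl dotC mulrAC divff ?mul1r// gt_eqF.
have qE : p ^+ 2 + q ^+ 2 = dot y y.
  by rewrite sqr_sqrtr; [ring|rewrite subr_ge0 pE; exact: dot_unit_le].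
split=> //; apply: (energy_model Fphi) => //.
- by rewrite rr.
- by rewrite -/r enorm_sqr.
- by rewrite /p mulrC divfK// rr gt_eqF.
Qed.

Lemma mem_radii_enorm x : Omega x -> x != 0 -> J (enorm x).
Proof. by move=> Ox x0; exists x. Qed.

Lemma snd_quadratic_radial (al be : R) x y :
  snd_quadratic (fun a b => al * x ord0 a * x ord0 b + be * (a == b)%:R) (x, y) =
  al * dot x y ^+ 2 + be * dot y y.
Proof.
rewrite /snd_quadratic /snd_linear/=.
have -> : al * dot x y ^+ 2 + be * dot y y =
    \sum_(a < n) (y ord0 a * (al * x ord0 a * dot x y) + y ord0 a * (be * y ord0 a)).
  rewrite big_split/= expr2 mulrA; apply: addr_congr.
    rewrite [X in _ * X = _](erefl : dot x y = \sum_(i < n) x ord0 i * y ord0 i) mulr_sumr.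
    by apply: eq_bigr => a _; ring.
  rewrite [X in _ * X = _](erefl : dot y y = \sum_(i < n) y ord0 i * y ord0 i) mulr_sumr.
  by apply: eq_bigr => a _; ring.
apply: eq_bigr => a _; rewrite -mulrDr; congr (_ * _).
under eq_bigr => b _ do rewrite mulrDr.
rewrite big_split/=; apply: addr_congr.
  rewrite [X in _ = _ * X](erefl : dot x y = \sum_(i < n) x ord0 i * y ord0 i) mulr_sumr.
  by apply: eq_bigr => b _; ring.
rewrite (bigD1 a)//= eqxx mulr1 big1 ?addr0 1?mulrC// => b ba.
by rewrite eq_sym (negbTE ba) !mulr0.
Qed.

Lemma energy_quadratic_form x : (forall r, J r -> quadratic_at phi r) -> Omega x ->
  exists al be : R, forall y, y != 0 -> L (x, y) = al * dot x y ^+ 2 + be * dot y y.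
Proof.
(* The radius 0 is not in [radii], but at [x = 0] one has [s = 0] for all [y], so [L] is a multiple
   of [|y|^2] anyway. *)
move=> qJ Ox; have [x0|x0] := eqVneq x 0.
  exists 0, (phi 0 0 ^+ 2) => y y0; rewrite mul0r add0r /energy/=.
  have [_ ->] := Fphi Ox y0.
  have -> : svar x y = 0 by rewrite /svar x0 dot0l mul0r.
  have -> : enorm x = 0 by rewrite /enorm x0 dot0l sqrtr0.
  by rewrite exprMn enorm_sqr mulrC.
have [al [be H]] := qJ _ (mem_radii_enorm Ox x0).
have r0 := enorm_gt0 x0.
(* Substitute [p = <x, y> / r] and [q^2 = |y|^2 - p^2] in [al p^2 + be q^2]. *)
exists ((al - be) / enorm x ^+ 2), be => y y0.
have [-> ] := energy_radial Ox x0 y0.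
set p := _ / _; set q := Num.sqrt _ => pq.
rewrite H; last first.
  apply: contraTT (dot_gt0 y0); rewrite -pq negb_or !negbK => /andP[/eqP -> /eqP ->].
  by rewrite !expr0n/= addr0 ltxx.
rewrite -pq /p; field.
by rewrite gt_eqF.
Qed.

Lemma quadratic_riemannian : (forall r, J r -> quadratic_at phi r) -> riemannian Omega F.
Proof.
move=> qJ; apply/riemannian_energy => x y y' i j Ox y0 y'0.
have [al [be H]] := energy_quadratic_form qJ Ox.
have H' z : z != 0 -> L (x, z) =
    snd_quadratic (fun a b => al * x ord0 a * x ord0 b + be * (a == b)%:R) (x, z).
  by move=> z0; rewrite H// snd_quadratic_radial.
by rewrite (dy2_quadratic i j y0 H') (dy2_quadratic i j y'0 H').
Qed.

(** Near a given radius this is [L] on the affine line [t -> (t e, e)]. *)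
Lemma smooth_radial_energy : smooth_on (V := R^o) J lam.
Proof.
move=> vs r Jr; have [r0 [e [v [e1 v1 ev Ore]]]] := radiiP n_ge2 Jr.
pose T : set R^o := [set t | 0 < t] `&` (fun t : R => t *: e) @^-1` Omega.
have oT : open T.
  apply: openI; first exact: open_gt.
  by apply: open_comp => // t _; exact: scalel_continuous.
suff : smooth_on (V := R^o) T lam by apply; split.
pose G (t : R) : R := L ((0, e) + t *: ((e, 0) : V * V)).
apply: (@smooth_on_eq _ _ _ oT G).
  move=> t [t0 Ote]; rewrite /G.
  have -> : (0, e) + t *: ((e, 0) : V * V) = (t *: e, 1 *: e + 0 *: v).
    by congr pair; rewrite /= ?scaler0 ?scale1r ?scale0r ?addr0 ?add0r.
  by apply: (energy_plane_model Fphi) => //; rewrite oner_neq0.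
apply: (@smooth_on_line _ _ W L) => // t [t0 Ote]; split=> /=.
  by rewrite add0r.
by rewrite scaler0 addr0 unit_neq0.
Qed.


Definition log_radial_energy' (r : R) : R := 'D_(1 : R^o) (lam : R^o -> R^o) r / lam r.

(** The solution of [2/r - 2 r^3 c2 = - lam' / lam], so that [g = 1 / lam]. *)
Definition cylinder_c2 (r : R) : R := (r^-1 + 2^-1 * log_radial_energy' r) / r ^+ 3.

Lemma radii_gt0 r : J r -> 0 < r.
Proof. by move=> /(radiiP n_ge2)[]. Qed.

Lemma lam_gt0 r : J r -> 0 < lam r.
Proof. exact: (radial_energy_gt0 n_ge2 finslerF Fphi). Qed.

Lemma is_derive_lam r : J r -> is_derive r (1 : R) lam (log_radial_energy' r * lam r).
Proof.
move=> Jr; have dl := smooth_on_differentiable smooth_radial_energy Jr.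
have H := derivableP (diff_derivable (v := (1 : R^o)) dl).
apply: (is_derive_eq H); rewrite /log_radial_energy' divfK// gt_eqF//; exact: lam_gt0.
Qed.

Lemma smooth_cylinder_c2 : smooth_on (V := R^o) J cylinder_c2.
Proof.
have oJ : open (J : set R^o) := open_radii n_ge2 domO.
have sid : smooth_on (V := R^o) J (id : R^o -> R^o).
  by apply: (@smooth_on_linear _ _ _ (idfun : {linear R^o -> R^o})) => // t; exact: cvg_id.
have sinv : smooth_on (V := R^o) J (fun t : R^o => (t : R)^-1).
  by apply: (@smooth_onV _ _ _ oJ id) => // t Jt; rewrite gt_eqF// radii_gt0.
have slam := smooth_radial_energy.
have sD : smooth_on (V := R^o) J ('D_(1 : R^o) (lam : R^o -> R^o)) := smooth_on_derive (1 : R^o) slam.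
have slV : smooth_on (V := R^o) J (fun t => (lam t)^-1).
  by apply: (@smooth_onV _ _ _ oJ lam) => // t Jt; rewrite gt_eqF// lam_gt0.
have slog : smooth_on (V := R^o) J log_radial_energy' := smooth_onM oJ sD slV.
have sc : smooth_on (V := R^o) J (fun t => 2^-1 * log_radial_energy' t).
  exact: (@smooth_onM _ _ _ oJ (cst (2^-1 : R)) _ (smooth_on_cst oJ _) slog).
have s3 : smooth_on (V := R^o) J (fun t => (t : R)^-1 * ((t : R)^-1 * (t : R)^-1)).
  exact: (smooth_onM oJ sinv (smooth_onM oJ sinv sinv)).
apply: (@smooth_on_eq _ _ _ oJ (fun t : R^o => ((t : R)^-1 + 2^-1 * log_radial_energy' t)
   * ((t : R)^-1 * ((t : R)^-1 * (t : R)^-1)))).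
  by move=> t _; rewrite /cylinder_c2 !exprS expr0 mulr1 !invfM.
exact: (smooth_onM oJ (smooth_onD oJ sinv sc) s3).
Qed.

Lemma antiderivative_I1 : antiderivative_on J
  (fun r => 2 / r - 2 * r ^+ 3 * cylinder_c2 r) (fun r => - ln (lam r)).
Proof.
move=> r Jr; have [r0 l0] := (radii_gt0 Jr, lam_gt0 Jr).
have H := is_deriveN (is_derive1_comp (is_derive1_ln l0) (is_derive_lam Jr)).
apply: (is_derive_eq H); rewrite /cylinder_c2; field.
by rewrite !gt_eqF.
Qed.

(** The constant 1 is the one that turns the argument of psi into [1 / (1 + (Q / P)^2)]. *)
Lemma antiderivative_I2 : antiderivative_on J
  (fun r => 2 * r * cylinder_c2 r * expR (- ln (lam r))) (fun r => 1 - (r ^+ 2 * lam r)^-1).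
Proof.
move=> r Jr; have [r0 l0] := (radii_gt0 Jr, lam_gt0 Jr).
have rl : r ^+ 2 * lam r != 0 by rewrite mulf_neq0 ?expf_neq0// gt_eqF.
have d2 : is_derive r (1 : R) (fun t : R => t ^+ 2) (2 * r).
  have H := is_deriveX 2 (is_derive_id r (1 : R)).
  by apply: (is_derive_eq H); rewrite /GRing.scale/= expr1 mulr1.
have d3 := is_deriveM d2 (is_derive_lam Jr).
have H := is_deriveB (is_derive_cst (1 : R) r (1 : R))
  (@is_deriveV R (fun t => t ^+ 2 * lam t) r _ 1 rl d3).
apply: (is_derive_eq H); rewrite expRN lnK ?posrE// /cylinder_c2 /GRing.scale/=; field.
by rewrite !gt_eqF.
Qed.

(** Here [exp (- I3) = sqrt lam / r]; as [u s = r p], the factor [exp (- I3) u s] of the formula is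
    the component [P]. *)
Lemma antiderivative_I3 : antiderivative_on J
  (fun r => 2 / r - r ^+ 3 * cylinder_c2 r) (fun r => ln r - ln (Num.sqrt (lam r))).
Proof.
move=> r Jr; have [r0 l0] := (radii_gt0 Jr, lam_gt0 Jr).
have s0 : 0 < Num.sqrt (lam r) by rewrite sqrtr_gt0.
have ds : is_derive r (1 : R) (Num.sqrt \o lam) ((2 * Num.sqrt (lam r))^-1 * (log_radial_energy' r * lam r)).
  by apply: is_derive1_comp; [exact: is_derive1_sqrt|exact: is_derive_lam].
have H := is_deriveB (is_derive1_ln r0)
  (@is_derive1_comp R (@ln R) (Num.sqrt \o lam) r _ _ (is_derive1_ln s0) ds).
apply: (is_derive_eq H); rewrite /cylinder_c2.
have -> : lam r = Num.sqrt (lam r) ^+ 2 by rewrite sqr_sqrtr// ltW.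
rewrite sqrtr_sqr ger0_norm ?ltW//; field.
by rewrite !gt_eqF.
Qed.

Lemma modelZ r (c p q : R) : 0 < c -> model phi r (c * p) (c * q) = c ^+ 2 * model phi r p q.
Proof.
move=> c0; rewrite /model.
have -> : (c * p) ^+ 2 + (c * q) ^+ 2 = c ^+ 2 * (p ^+ 2 + q ^+ 2) by ring.
rewrite sqrtrM ?sqr_ge0// sqrtr_sqr gtr0_norm//.
have -> : r * (c * p) / (c * Num.sqrt (p ^+ 2 + q ^+ 2)) = r * p / Num.sqrt (p ^+ 2 + q ^+ 2).
  by rewrite mulrCA -mulf_div divff ?mul1r// gt_eqF.
by rewrite mulrA.
Qed.

Lemma cylinder_modelZ r (c P Q : R) : 0 < c ->
  cylinder_model phi r (c * P) (c * Q) = c ^+ 2 * cylinder_model phi r P Q.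
Proof. by move=> c0; rewrite /cylinder_model -modelZ// !mulrA. Qed.

(* On the cylinder, F is determined by its values on (+-1, tau), and tau^2 = 1/z - 1 where z is the
   argument of psi. *)
Lemma cylinder_berwald_form r0 : J r0 ->
  (forall r P Q, J r -> (P != 0) || (Q != 0) ->
    cylinder_model phi r P Q = cylinder_model phi r0 P Q) ->
  exists psi, berwald_form Omega F cylinder_c2 psi.
Proof.
move=> Jr0 H; pose sg (b : bool) : R := if b then 1 else -1.
(* [z^-1 - 1] will be [(Q / P)^2]. The sign makes [psi] times [s] positive on both components. *)
exists (fun b z => sg b * Num.sqrt (cylinder_model phi r0 (sg b) (Num.sqrt (z^-1 - 1)))).
exists (fun r => - ln (lam r)), (fun r => 1 - (r ^+ 2 * lam r)^-1), (fun r => ln r - ln (Num.sqrt (lam r))).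
split; [exact: antiderivative_I1|exact: antiderivative_I2|exact: antiderivative_I3|].
move=> x y Ox y0 r u s s0.
have x0 : x != 0 by apply: contraNneq s0 => x0; rewrite /s /svar x0 dot0l mul0r.
have Jr : J r := mem_radii_enorm Ox x0.
have [rp lp] := (radii_gt0 Jr, lam_gt0 Jr).
have up : 0 < u := enorm_gt0 y0.
have f0 : 0 < Num.sqrt (lam r) by rewrite sqrtr_gt0.
set f := Num.sqrt (lam r) in f0 *.
have lf : lam r = f ^+ 2 by rewrite sqr_sqrtr// ltW.
have [LE] := energy_radial Ox x0 y0; rewrite -/r in LE *.
set p := dot x y / r in LE *; set q := Num.sqrt _ in LE * => pq.
have q0 : 0 <= q := sqrtr_ge0 _.
have us : u * s = r * p by rewrite /s /svar /p mulrC divfK ?gt_eqF// mulrC divfK// gt_eqF.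
have uu : u ^+ 2 = p ^+ 2 + q ^+ 2 by rewrite pq enorm_sqr.
have fE : Num.sqrt (lam r) = f by [].
clearbody q; clearbody p f; clearbody s u r.
have pn0 : p != 0.
  by apply: contraNneq s0 => p0; move/eqP: us; rewrite p0 mulr0 mulf_eq0 (gt_eqF up).
have sE : s = r * p / u by rewrite -us mulrAC divff ?mul1r// gt_eqF.
have [rn un fn] := And3 (lt0r_neq0 rp) (lt0r_neq0 up) (lt0r_neq0 f0).
(* This is [|Q / P|] for [P = f p] and [Q = q / r]. *)
pose tau := q / (r * `|p| * f).
have tau2 : tau ^+ 2 = q ^+ 2 / (r ^+ 2 * p ^+ 2 * f ^+ 2).
  by rewrite /tau expr_div_n !exprMn (real_normK (num_real p)).
have denomE : expR (- ln (lam r)) + s ^+ 2 * (1 - (r ^+ 2 * lam r)^-1) = s ^+ 2 * (1 + tau ^+ 2).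
  rewrite expRN lnK ?posrE// lf tau2.
  have -> : q ^+ 2 = u ^+ 2 - p ^+ 2 by rewrite uu addrAC subrr add0r.
  rewrite sE; field.
  by rewrite un pn0 fn rn.
have t1 : 1 + tau ^+ 2 != 0 by rewrite gt_eqF// ltr_wpDr ?sqr_ge0.
rewrite denomE; split; first by rewrite mulf_neq0// expf_neq0.
have -> : (s ^+ 2 / (s ^+ 2 * (1 + tau ^+ 2)))^-1 - 1 = tau ^+ 2.
  by field; rewrite t1 s0.
have tau0 : 0 <= tau by rewrite divr_ge0// !mulr_ge0// ?ltW.
rewrite sqrtr_sqr (ger0_norm tau0).
have s_gt0 : (0 < s) = (0 < p).
  by rewrite -(pmulr_rgt0 _ up) us pmulr_rgt0.
have sgp : p = sg (0 < s) * `|p|.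
  by rewrite s_gt0 /sg; case: (ltrP 0 p) => p1;
    [rewrite gtr0_norm// mul1r|rewrite ler0_norm// mulN1r opprK].
have c0 : 0 < `|p| * f by rewrite mulr_gt0// normr_gt0.
have Fp : 0 < F x y by have [pos _ _ _] := finslerF; exact: pos.
(* Degree 2 pulls out [|P|], which leaves the point [(+-1, tau)]; the radius may then be changed to
   [r0]. *)
have FE : F x y = `|p| * f * Num.sqrt (cylinder_model phi r0 (sg (0 < s)) tau).
  have -> : F x y = Num.sqrt (L (x, y)) by rewrite /energy/= sqrtr_sqr gtr0_norm.
  rewrite -[`|p| * f]gtr0_norm// -sqrtr_sqr -sqrtrM ?sqr_ge0// -cylinder_modelZ//.
  rewrite -(H r)//; last first.
    rewrite /sg; case: ifP => _; rewrite ?mulr1 ?mulrN1 ?oppr_eq0 gt_eqF//.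
  rewrite LE /cylinder_model fE; congr (Num.sqrt (model phi r _ _)).
    by rewrite {1}sgp mulrAC mulrK ?unitfE// mulrC.
  rewrite /tau; field.
  by rewrite rn fn normr_eq0 pn0.
rewrite FE opprB expRD expRN !lnK ?posrE//.
have -> : u * (sg (0 < s) * Num.sqrt (cylinder_model phi r0 (sg (0 < s)) tau)) * (f / r) * s =
  (u * s) * sg (0 < s) * f / r * Num.sqrt (cylinder_model phi r0 (sg (0 < s)) tau) by field.
rewrite us; congr (_ * _).
have sg2 : sg (0 < s) * sg (0 < s) = 1 by rewrite /sg; case: ifP => _; rewrite ?mulr1 ?mulrNN ?mulr1.
rewrite {2}sgp.
have -> : r * (sg (0 < s) * `|p|) * sg (0 < s) * f / r =
   (sg (0 < s) * sg (0 < s)) * (`|p| * f) by field.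
by rewrite sg2 mul1r.
Qed.

Lemma berwald_forward : berwald_metric Omega F -> riemannian Omega F \/
  exists (c2 : R -> R) (psi : bool -> R -> R),
     smooth_on (V := R^o) (radii Omega) c2 /\ berwald_form Omega F c2 psi.
Proof.
move=> bF; have [qJ|[r0 Jr0 H]] := berwald_global n_ge2 domO finslerF Fphi bF.
  by left; exact: quadratic_riemannian.
right; have [psi Hpsi] := cylinder_berwald_form Jr0 H.
by exists cylinder_c2, psi; split=> //; exact: smooth_cylinder_c2.
Qed.

End Forward.

(** * From the formula to Berwald metrics *)

Section BilinearConnection.
Context {R : realType} {n : nat}.
Local Notation V := 'rV[R]_n.
Local Notation e := (basis_vec R).

Lemma christoffel_bilinear (B : V -> V -> V) (y w : V) :
  (forall u v z, B (u + v) z = B u z + B v z) -> (forall (a : R) u z, B (a *: u) z = a *: B u z) ->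
  (forall u v z, B z (u + v) = B z u + B z v) -> (forall (a : R) u z, B z (a *: u) = a *: B z u) ->
  christoffel (fun i l m => B (e l) (e m) ord0 i) y w = B y w.
Proof.
move=> Dl Zl Dr Zr.
have l0 z : B 0 z = 0 by have := Zl 0 0 z; rewrite !scale0r.
have r0 z : B z 0 = 0 by have := Zr 0 0 z; rewrite !scale0r.
have suml (a : 'I_n -> R) z : B (\sum_(l < n) a l *: e l) z = \sum_(l < n) a l *: B (e l) z.
  rewrite (big_morph (B ^~ z) (fun u v => Dl u v z) (l0 z)).
  by apply: eq_bigr => l _; rewrite Zl.
have sumr (a : 'I_n -> R) z : B z (\sum_(l < n) a l *: e l) = \sum_(l < n) a l *: B z (e l).
  rewrite (big_morph (B z) (fun u v => Dr u v z) (r0 z)).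
  by apply: eq_bigr => l _; rewrite Zr.
apply/rowP => i; rewrite [in RHS](row_basis y) [in RHS](row_basis w) suml mxE summxE.
apply: eq_bigr => l _; rewrite sumr !mxE summxE mulr_sumr; apply: eq_bigr => m _.
by rewrite mxE mulrA.
Qed.

Lemma christoffel_basis (Gam : 'I_n -> 'I_n -> 'I_n -> R) (y : V) k i :
  christoffel Gam y (e k) ord0 i = \sum_(l < n) y ord0 l * Gam i l k.
Proof.
rewrite mxE; apply: eq_bigr => l _; rewrite (bigD1 k)//= mxE !eqxx mulr1 big1 ?addr0// => m mk.
by rewrite mxE eqxx (negbTE mk) mulr0 mul0r.
Qed.

End BilinearConnection.

(** * The spray determined by a linear connection *)

Section SprayOfConnection.
Context {R : realType} {n : nat}.
Local Notation V := 'rV[R]_n.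
Variables (Omega : set V) (F : V -> V -> R).
Hypothesis openO : open Omega.
Hypothesis finslerF : finsler_metric Omega F.
Local Notation W := (slit Omega).
Local Notation L := (energy F).
Local Notation e := (basis_vec R).

Let oW : open W. Proof. exact: open_slit. Qed.
Let sL : smooth_on W L. Proof. exact: smooth_energy. Qed.

(** Substitute the connection in [spray_rhs]: by symmetry of [Gam], the terms with first derivatives
    of [L] add up to [dx (e l) L] and cancel. What is left is the linear system solved by
    [G^i = Gam^i_{lm} y^l y^m / 2]. *)
Lemma spray_of_connection x (Gam : 'I_n -> 'I_n -> 'I_n -> R) : Omega x ->
  (forall i l m, Gam i l m = Gam i m l) ->
  (forall y w, y != 0 -> dx w L (x, y) = dy (christoffel Gam y w) L (x, y)) ->
  forall y i, y != 0 ->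
    spray_coef F i (x, y) = snd_quadratic (fun l m => Gam i l m / 2) (x, y).
Proof.
move=> Ox Gsym H y i y0; have Wxy : W (x, y) by [].
pose Q (i : 'I_n) := snd_quadratic (fun l m => Gam i l m / 2) (x, y).
apply: (spray_eqP finslerF Q Wxy).1 => l {i}.
have slin i k : smooth_on W (snd_linear (fun a => Gam i a k)).
  apply: (@smooth_on_sum_mul _ _ _ oW (@snd_coord R n) (fun a _ => Gam i a k)) => a.
    exact: smooth_snd_coord.
  exact: smooth_on_cst.
have sdy i : smooth_on W (dy (e i) L) by exact: smooth_dy.
have Hk k z : z != 0 -> dx (e k) L (x, z) =
    \sum_(i < n) snd_linear (fun a => Gam i a k) (x, z) * dy (e i) L (x, z).
  move=> z0; have Wxz : W (x, z) by [].
  rewrite (H z (e k) z0) (dy_sum_basis _ sL Wxz); apply: eq_bigr => i _.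
  by rewrite christoffel_basis.
have Dk k : dx (e k) (dy (e l) L) (x, y) =
    \sum_(i < n) Gam i l k * dy (e i) L (x, y) +
    \sum_(i < n) snd_linear (fun a => Gam i a k) (x, y) * dy (e l) (dy (e i) L) (x, y).
  rewrite (dxyC oW (e k) (e l) sL Wxy).
  rewrite (@dy_slice _ _ (e l) _ (fun q => \sum_(i < n) snd_linear (fun a => Gam i a k) q * dy (e i) L q) x y y0 (Hk k)).
  rewrite (@dy_sum_mul _ _ W (e l) _ _ (x, y) (fun i => slin i k) sdy Wxy).
  by apply: addr_congr => //; apply: eq_bigr => i _; rewrite dy_snd_linear.
rewrite /spray_rhs/=.
under eq_bigr => k _ do rewrite Dk mulrDr.
rewrite big_split/=.
have E1 : \sum_(k < n) y ord0 k * (\sum_(i < n) Gam i l k * dy (e i) L (x, y)) = dx (e l) L (x, y).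
  rewrite Hk//; under eq_bigr => k _ do rewrite mulr_sumr.
  rewrite exchange_big/=; apply: eq_bigr => i _; rewrite /snd_linear/= mulr_suml.
  by apply: eq_bigr => k _; rewrite Gsym mulrA.
rewrite E1 addrAC subrr add0r; under eq_bigr => k _ do rewrite mulr_sumr.
rewrite exchange_big/= mulr_sumr; apply: eq_bigr => i _.
rewrite /Q /snd_quadratic mulrA mulr_sumr mulr_suml; apply: eq_bigr => k _.
rewrite mulrA; congr (_ * _); rewrite mulrCA; congr (_ * _).
rewrite /snd_linear mulr_sumr; apply: eq_bigr => a _.
by rewrite Gsym/=; field.
Qed.

Lemma connection_berwald x (Gam : 'I_n -> 'I_n -> 'I_n -> R) : Omega x ->
  (forall i l m, Gam i l m = Gam i m l) ->
  (forall y w, y != 0 -> dx w L (x, y) = dy (christoffel Gam y w) L (x, y)) ->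
  forall y i j k l, y != 0 -> berwald_curvature F i j k l x y = 0.
Proof.
move=> Ox Gsym H y i j k l y0; rewrite berwald_curvatureE.
by apply: dy3_quadratic => // z z0; exact: spray_of_connection.
Qed.

End SprayOfConnection.

(** * The product connection carried by the formula *)

Section Backward.
Context {R : realType} {n : nat}.
Local Notation V := 'rV[R]_n.
Variables (Omega : set V) (F : V -> V -> R) (phi : R -> R -> R).
Hypothesis n_ge2 : (2 <= n)%N.
Hypothesis domO : domain Omega.
Hypothesis finslerF : finsler_metric Omega F.
Hypothesis Fphi : radial_form Omega F phi.
Variables (c2 : R -> R) (psi : bool -> R -> R).
Hypothesis form : berwald_form Omega F c2 psi.
Local Notation W := (slit Omega).
Local Notation L := (energy F).
Local Notation J := (radii Omega).
Implicit Types (x y u v w : V).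

Let openO : open Omega. Proof. by have [] := domO. Qed.
Let oW : open W. Proof. exact: open_slit. Qed.
Let sL : smooth_on W L. Proof. exact: smooth_energy. Qed.

Section AtPoint.
Variables (r : R) (e : V).
Hypotheses (r0 : 0 < r) (e1 : dot e e = 1) (Ore : Omega (r *: e)).

Local Notation eta := (r^-1 - r ^+ 3 * c2 r).

(* F is constant along the curve [(rho e, P rho e + (rho / r) z)] with [P ~ sqrt (g rho)]: on it both
   the argument of psi and the factor [u s exp (- I3)] are constant. *)
Lemma form_radial_generic (p : R) z : p != 0 -> dot z e = 0 ->
  dx e L (r *: e, p *: e + z) =
  - (p * eta * dy e L (r *: e, p *: e + z) + r^-1 * dy z L (r *: e, p *: e + z)).
Proof.
move=> p0 ze; have rn0 : r != 0 by rewrite gt_eqF.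
have ez : dot e z = 0 by rewrite dotC.
have [I1 [I2 [I3 [dI1 dI2 dI3 HF]]]] := form.
pose P (t : R) : R := p * expR ((I1 t - I1 r) / 2).
pose Y (t : R) : V := P t *: e + (t / r) *: z.
have Pn0 t : P t != 0 by rewrite mulf_neq0// gt_eqF// expR_gt0.
have Ye t : dot (Y t) e = P t by rewrite !dotE e1 ze; ring.
have YY t : dot (Y t) (Y t) = P t ^+ 2 + (t / r) ^+ 2 * dot z z by rewrite !dotE e1 ze ez; ring.
have Yn0 t : Y t != 0 by apply: contraNneq (Pn0 t) => Y0; rewrite -(Ye t) Y0 dot0l.
have Yr : Y r = p *: e + z by rewrite /Y /P subrr mul0r expR0 mulr1 divff// scale1r.
have N : \forall t \near r, 0 < t /\ Omega (t *: e).
  by apply: filterI; [exact: lt_nbhsr|exact: near_ray].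
have [d /= d0 Hd] := (nbhs_ballP _ _).1 N.
have inb (t : R) : r - d < t < r + d -> [/\ 0 < t, Omega (t *: e) & J t].
  move=> tI; have [|t0 Ot] := Hd t; first by rewrite /ball/= ltr_distlC.
  by split=> //; exact: mem_radii Ot.
have rI : r - d < r < r + d by rewrite ltrDl d0 andbT gtrBl.
(* Along the curve, [A] is the part of the inverse of the argument of psi that does not involve [z],
   and [B] is the logarithm of [|u s| exp (- I3)] up to a constant. The three integrands cancel in
   both derivatives, whatever the constants of integration. *)
pose A (t : R) : R := expR (I1 t) / t ^+ 2 + I2 t.
pose B (t : R) : R := ln t + 2^-1 * I1 t - I3 t.
have dA t : r - d < t < r + d -> is_derive t (1 : R) A 0.
  move=> /inb[t0 Ot Jt]; have tn0 : t != 0 by rewrite gt_eqF.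
  have d2 : is_derive t (1 : R) (fun s : R => s ^+ 2) (2 * t).
    have H := is_deriveX 2 (is_derive_id t (1 : R)).
    by apply: (is_derive_eq H); rewrite /GRing.scale/= expr1 mulr1.
  have t2 : t ^+ 2 != 0 by rewrite expf_neq0.
  have dg := @is_derive1_comp R expR I1 t _ _ (is_derive_expR _) (dI1 t Jt).
  have H := is_deriveD (is_deriveM dg (@is_deriveV R (fun s => s ^+ 2) t _ 1 t2 d2)) (dI2 t Jt).
  by apply: (is_derive_eq H); rewrite /GRing.scale/=; field.
have dB t : r - d < t < r + d -> is_derive t (1 : R) B 0.
  move=> /inb[t0 Ot Jt]; have tn0 : t != 0 by rewrite gt_eqF.
  have H := is_deriveB (is_deriveD (is_derive1_ln t0) (is_deriveZ (2^-1) (dI1 t Jt))) (dI3 t Jt).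
  by apply: (is_derive_eq H); rewrite /GRing.scale/=; field.
have FE t : r - d < t < r + d -> F (t *: e) (Y t) =
    p * expR (B r - 2^-1 * I1 r) *
    psi (0 < p) ((dot z z * expR (I1 r) / (r ^+ 2 * p ^+ 2) + A r)^-1).
  move=> tI; have [t0 Ot Jt] := inb t tI; have tn0 : t != 0 by rewrite gt_eqF.
  have tE : enorm (t *: e) = t by rewrite enormZ ?ltW// enorm_unit// mulr1.
  have := HF (t *: e) (Y t) Ot (Yn0 t).
  have := enorm_gt0 (Yn0 t); have := enorm_sqr (Y t); have : svar (t *: e) (Y t) = t * P t / enorm (Y t).
    by rewrite /svar dotZl dotC Ye.
  rewrite tE YY; set u := enorm _; set s := svar _ _ => sE uu u0 HFt.
  clearbody s; clearbody u.
  have un0 : u != 0 by rewrite gt_eqF.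
  have sn0 : s != 0 by rewrite sE; apply: mulf_neq0; [exact: mulf_neq0|rewrite invr_eq0].
  have [_ ->] := HFt sn0.
  have sgn : (0 < s) = (0 < p).
    by rewrite sE pmulr_lgt0 ?invr_gt0// pmulr_rgt0// /P pmulr_lgt0// expR_gt0.
  rewrite sgn -(derive0_constant dA tI rI) -(derive0_constant dB tI rI).
  have gP : expR (I1 t) = expR (I1 r) * (P t / p) ^+ 2.
    have -> : P t / p = expR ((I1 t - I1 r) / 2) by rewrite /P mulrAC divff ?mul1r.
    by rewrite expr2 -!expRD; congr expR; field.
  (* Since [u^2 = P^2 + (t / r)^2 |z|^2] and [g] is proportional to [P^2] along the curve, [t]
     disappears from the term with [|z|^2]. *)
  have -> : s ^+ 2 / (expR (I1 t) + s ^+ 2 * I2 t) =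
      (dot z z * expR (I1 r) / (r ^+ 2 * p ^+ 2) + A t)^-1.
    rewrite -invf_div; congr (_^-1).
    have -> : (expR (I1 t) + s ^+ 2 * I2 t) / s ^+ 2 =
        expR (I1 t) * u ^+ 2 / (t * P t) ^+ 2 + I2 t.
      by rewrite sE; field; rewrite un0 Pn0 tn0.
    by rewrite uu /A gP; field; rewrite p0 rn0 tn0 Pn0.
  have -> : u * psi (0 < p) ((dot z z * expR (I1 r) / (r ^+ 2 * p ^+ 2) + A t)^-1) * expR (- I3 t) * s
      = (u * s) * expR (- I3 t) * psi (0 < p) ((dot z z * expR (I1 r) / (r ^+ 2 * p ^+ 2) + A t)^-1).
    by ring.
  congr (_ * _); rewrite sE /B /P.
  have -> : ln t + 2^-1 * I1 t - I3 t - 2^-1 * I1 r = ln t + ((I1 t - I1 r) / 2 - I3 t) by field.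
  rewrite expRD lnK ?posrE// expRD; field.
  exact: un0.
have dP : is_derive r (1 : R) P (p * eta).
  have Hh : is_derive r (1 : R) (fun t => (I1 t - I1 r) / 2) eta.
    have Jr : J r by have [] := inb r rI.
    have H := is_deriveM (is_deriveB (dI1 r Jr) (is_derive_cst (I1 r) r (1 : R))) (is_derive_cst (2^-1 : R) r (1 : R)).
    by apply: (is_derive_eq H); rewrite /GRing.scale/=; field.
  have H := is_deriveZ p (@is_derive1_comp R expR (fun t => (I1 t - I1 r) / 2) r _ _ (is_derive_expR _) Hh).
  by apply: (is_derive_eq H); rewrite /GRing.scale/= subrr mul0r expR0 mul1r.
have dY : is_derive r (1 : R) Y ((p * eta) *: e + r^-1 *: z).
  apply: is_deriveD; first exact: is_derive_scalev.
  apply: is_derive_scalev.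
  have H := is_deriveM (is_derive_id r (1 : R)) (is_derive_cst (r^-1 : R) r (1 : R)).
  by apply: (is_derive_eq H); rewrite /GRing.scale/= mulr0 add0r mulr1.
pose c (t : R) : V * V := (t *: e, Y t).
have dc : is_derive r (1 : R) c (1 *: e, (p * eta) *: e + r^-1 *: z).
  by apply: is_derive_pair => //; exact: is_derive_scalev.
have Wc : W (c r) by split=> //=; exact: Yn0.
have dL : differentiable (L : V * V -> R^o) (c r) by exact: smooth_on_differentiable Wc.
have := derive_curve_eq0 dc dL (k := L (c r)).
have -> : ((1 *: e, (p * eta) *: e + r^-1 *: z) : V * V) = (e, 0) + (0, (p * eta) *: e + r^-1 *: z).
  by congr pair; rewrite /= ?addr0 ?scale1r// add0r.
rewrite (derive_dirD dL) => H.
have {H} : dx e L (c r) + dy ((p * eta) *: e + r^-1 *: z) L (c r) = 0.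
  rewrite dx.unlock dy.unlock; apply: H.
  have nb : \forall t \near r, r - d < t < r + d.
    by apply/nbhs_ballP; exists d => //= t; rewrite /ball/= ltr_distlC.
  by apply: filterS nb => t tI; rewrite /energy/= FE// -(FE r rI).
rewrite (dy_dirD _ _ sL Wc) !(dy_dirZ _ _ sL Wc) /c Yr => /eqP.
by rewrite addr_eq0 => /eqP.
Qed.

(** Where [dot y e = 0] one has [s = 0] and the formula is silent; there [y] is shifted by [t e] and
    [t] tends to 0. *)
Lemma form_radial y : y != 0 ->
  dx e L (r *: e, y) =
  - (dot y e * eta * dy e L (r *: e, y) + r^-1 * dy (y - dot y e *: e) L (r *: e, y)).
Proof.
move=> y0; set p := dot y e; set z := y - p *: e.
have ze : dot z e = 0 by rewrite /z !dotE e1 mulr1 subrr.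
have yE (t : R) : y + t *: e = (p + t) *: e + z.
  by rewrite /z scalerDl [RHS]addrC addrA subrK.
have [pn0|pn0] := eqVneq p 0; last first.
  by have -> : y = p *: e + z; [rewrite -[LHS]addr0 -(scale0r e) yE addr0|exact: form_radial_generic].
pose f (t : R) : R := dx e L (r *: e, y + t *: e) + ((p + t) * eta * dy e L (r *: e, y + t *: e)
   + r^-1 * dy z L (r *: e, y + t *: e)).
suff : f 0 = 0 by rewrite /f scale0r !addr0 => /eqP; rewrite addr_eq0 => /eqP.
apply: continuous_eq0 => [|t t0]; last first.
  by rewrite /f yE form_radial_generic ?addNr// pn0 add0r.
have y00 : y + (0 : R) *: e != 0 by rewrite scale0r addr0.
have cX := continuous_vertical (smooth_dx e sL) Ore y00.
have ce := continuous_vertical (smooth_dy e sL) Ore y00.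
have cz := continuous_vertical (smooth_dy z sL) Ore y00.
have cc (a : R) : {for (0 : R), continuous (cst a : R -> R)} by exact: cst_continuous.
have ci : {for (0 : R), continuous (id : R -> R)} by exact: cvg_id.
exact: (continuousD cX (continuousD (continuousM (continuousM (continuousD (cc p) ci) (cc eta)) ce)
  (continuousM (cc r^-1) cz))).
Qed.

(** The symmetric bilinear map that is the vector of [form_radial] for [w = e], and the generator of
    the rotations divided by [r] for [w] orthogonal to [e]. It is the Levi-Civita connection of
    [dr^2 / g] plus the round sphere, in Cartesian coordinates. *)
Definition form_connection (y w : V) : V :=
  r^-1 *: ((dot y e * dot w e + dot y w) *: e - (dot w e *: y + dot y e *: w))
  - (dot y e * dot w e * eta) *: e.

(** The radial part of [w] is [form_radial]; the part orthogonal to [e], normalised when nonzero, is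
    [dx_energy_rotation]. *)
Lemma form_horizontal y w : y != 0 ->
  dx w L (r *: e, y) = dy (form_connection y w) L (r *: e, y).
Proof.
move=> y0; have rn0 : r != 0 by rewrite gt_eqF.
have Wy : W (r *: e, y) by [].
set al := dot w e; set w' := w - al *: e.
have ew' : dot e w' = 0 by rewrite dotC /w' !dotE e1 mulr1 subrr.
have w'E : w' = w - al *: e by [].
clearbody w'.
have K : r * dx w' L (r *: e, y) = - dy (dot y e *: w' - dot y w' *: e) L (r *: e, y).
  have [w0|w0] := eqVneq w' 0.
    rewrite w0 dot0r scaler0 scale0r subr0 -(scale0r (0 : V)).
    by rewrite (dx_dirZ _ _ sL Wy) (dy_dirZ _ _ sL Wy) !mul0r mulr0 oppr0.
  have n0 : enorm w' != 0 by rewrite gt_eqF// enorm_gt0.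
  pose v := (enorm w')^-1 *: w'.
  have v1 : dot v v = 1 by rewrite !dotE -enorm_sqr; field.
  have ev : dot e v = 0 by rewrite !dotE ew' mulr0.
  have wvE : w' = enorm w' *: v by rewrite scalerA divff// scale1r.
  clearbody v.
  rewrite [in LHS]wvE (dx_dirZ _ _ sL Wy) mulrCA (dx_energy_rotation openO finslerF Fphi e1 Ore v1 ev y0).
  rewrite mulrN -(dy_dirZ _ _ sL Wy); congr (- dy _ _ _).
  by rewrite [in RHS]wvE dotZr scalerBr !scalerA ![enorm w' * _]mulrC.
have wE : w = al *: e + w' by rewrite w'E addrC subrK.
have Kx : dx w' L (r *: e, y) = - (r^-1 * dy (dot y e *: w' - dot y w' *: e) L (r *: e, y)).
  by rewrite -mulrN -K mulKf.
rewrite [in LHS]wE (dx_dirD _ _ sL Wy) (dx_dirZ _ _ sL Wy) Kx form_radial//.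
rewrite -!(dy_dirZ _ _ sL Wy) -(dy_dirD _ _ sL Wy) -!(dy_dirN _ sL Wy) -!(dy_dirZ _ _ sL Wy) -(dy_dirD _ _ sL Wy).
congr (dy _ _ _); rewrite /form_connection -/al w'E; apply/rowP => i.
by rewrite !mxE !dotE -/al; ring.
Qed.

Lemma form_berwald_at y i j k l : y != 0 -> berwald_curvature F i j k l (r *: e) y = 0.
Proof.
pose Gam (i l m : 'I_n) := form_connection (basis_vec R l) (basis_vec R m) ord0 i.
apply: (connection_berwald openO finslerF (Gam := Gam)) => // [a b c|y' w y'0].
  rewrite /Gam /form_connection (dotC (basis_vec R b) (basis_vec R c)).
  by rewrite !mxE; ring.
rewrite christoffel_bilinear ?form_horizontal// => *;
  by rewrite /form_connection; apply/rowP => ?; rewrite !dotE !mxE; ring.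
Qed.

End AtPoint.

(** At [x = 0], where the formula gives nothing, the curvature is the limit of its values at the
    points [t v], since it is continuous in [x]. *)
Lemma berwald_backward : berwald_metric Omega F.
Proof.
move=> x y Ox y0 i j k l.
have away z : Omega z -> z != 0 -> berwald_curvature F i j k l z y = 0.
  move=> Oz z0; have [r [e [r0 e1 zE _]]] := polar_decomposition z0.
  by rewrite zE in Oz *; exact: form_berwald_at.
have [x0|x0] := eqVneq x 0; last exact: away.
have [v v1 _] := exists_orthonormal (0 : V) n_ge2.
pose G := dy (basis_vec R j) (dy (basis_vec R k) (dy (basis_vec R l) (spray_coef F i))).
have sG : smooth_on W G by do 3 apply: smooth_dy; exact: smooth_spray.
pose c (t : R) : V * V := (x, y) + t *: ((v, 0) : V * V).
have cE t : c t = (x + t *: v, y) by congr pair; rewrite /= scaler0 addr0.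
have cc : {for (0 : R), continuous c}.
  by apply: differentiable_continuous; apply/derivable1_diffP; have [] := is_derive_line (x, y) ((v, 0) : V * V) 0.
have W0 : W (c 0) by rewrite cE scale0r addr0.
have cG : {for (0 : R), continuous (G \o c : R -> R)}.
  apply: continuous_comp => //.
  exact: differentiable_continuous (smooth_on_differentiable sG W0).
have : (G \o c) 0 = 0.
  apply: near_continuous_eq0 => //.
  have nW : \forall t \near (0 : R), W (c t) by apply: cc; exact: open_nbhs_nbhs.
  apply: filterS nW => t; rewrite cE => -[/= Ot _] t0.
  rewrite cE /G -berwald_curvatureE; apply: away => //.
  by rewrite x0 add0r scaler_eq0 negb_or t0 unit_neq0.
by rewrite /= cE scale0r addr0 /G -berwald_curvatureE.
Qed.

End Backward.

Theorem theorem3p2 (R : realType) (n : nat) (n_ge2 : (2 <= n)%N)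
    (Omega : set 'rV[R]_n) (F : 'rV[R]_n -> 'rV[R]_n -> R) (phi : R -> R -> R)
    (domOmega : domain Omega)
    (finslerF : finsler_metric Omega F)
    (symF : spherically_symmetric Omega F)
    (Fphi : radial_form Omega F phi) :
  berwald_metric Omega F <->
  (riemannian Omega F \/
   exists (c2 : R -> R) (psi : bool -> R -> R),
     smooth_on (V := R^o) (radii Omega) c2 /\ berwald_form Omega F c2 psi).
Proof.
split=> [bF|[rF|[c2 [psi [_ form]]]]].
- exact: (berwald_forward n_ge2 domOmega finslerF Fphi bF).
- by case: domOmega => _ openOmega _; exact: riemannian_berwald.
- exact: (berwald_backward n_ge2 domOmega finslerF Fphi form).
Qed.
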